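(* Let $Q$ be a finite acyclic quiver with $n$ vertices, $A=kQ$ over an algebraically closed field $k$, and $T$ a basic tilting $A$-module. Then $T$ is saturated if and only if $(\underline{\dim}\,T)_i\ge 2$ for all $1\le i\le n$.
   Context: $\underline{\dim}\,T\in\mathbb{Z}^n$ is the dimension vector of $T$ and $(\underline{\dim}\,T)_i$ its $i$-th coordinate. A tilting module $T$ satisfies $\mathrm{pd}_AT\le1$, $\mathrm{Ext}^1_A(T,T)=0$ and there is an exact sequence $0\to A\to T_1\to T_2\to0$ with $T_1,T_2$ direct summands of finite direct sums of copies of $T$. The tilting quiver $\overrightarrow{Q}(\mathrm{tilt}\,A)$ has as vertices the isomorphism classes of basic tilting $A$-modules and an arrow $T_1\to T_2$ whenever $T_1=M\oplus X$, $T_2=M\oplus Y$ with $X,Y$ indecomposable and there is a short exact sequence $0\to X\to M'\to Y\to0$ with $M'$ a direct summand of a finite direct sum of copies of $M$. Let $s(T)$ (resp. $e(T)$) be the number of arrows starting (resp. ending) at $T$ in $\overrightarrow{Q}(\mathrm{tilt}\,A)$; always $s(T)+e(T)\le n$, and $T$ is called saturated if $s(T)+e(T)=n$. *)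

(* Defs.v *)
(* Finite-dimensional representations of a finite quiver
   over a field, concretely: vertices 'I_n, arrows a finType Ar with
   source s and target t.  Vectors are ROW vectors: the map of a
   representation along an arrow a : s a -> t a is a matrix of size
   (dim at s a) x (dim at t a), acting by v |-> v *m M. *)
From HB Require Import structures.
From mathcomp Require Import all_boot all_order all_algebra.
Set Implicit Arguments. Unset Strict Implicit. Unset Printing Implicit Defensive.
Import GRing.Theory.
Local Open Scope ring_scope.

Section QuiverReps.
Variable F : fieldType.
Variable n : nat.
Variable Ar : finType.
Variables (s t : Ar -> 'I_n).

Fixpoint is_pathb (i j : 'I_n) (p : seq Ar) : bool :=
  match p with
  | [::] => i == j
  | a :: p' => (s a == i) && is_pathb (t a) j p'
  end.

Definition acyclic : Prop :=
  forall (i : 'I_n) (p : seq Ar), is_pathb i i p -> p = [::].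

Record rep := Rep {
  rdim : 'I_n -> nat;
  rmap : forall a : Ar, 'M[F]_(rdim (s a), rdim (t a)) }.

Definition zero_rep : rep :=
  @Rep (fun _ => 0%N) (fun a => 0 : 'M[F]_(0, 0)).

Definition is_zero (V : rep) : Prop := forall i, rdim V i = 0%N.

Definition dsum (V W : rep) : rep :=
  @Rep (fun i => (rdim V i + rdim W i)%N)
      (fun a => block_mx (rmap V a) 0 0 (rmap W a)).

Definition dsum_list (Vs : seq rep) : rep := foldr dsum zero_rep Vs.

Definition copies (m : nat) (V : rep) : rep := dsum_list (nseq m V).

Definition hom (V W : rep) := forall i : 'I_n, 'M[F]_(rdim V i, rdim W i).

Definition is_hom (V W : rep) (f : hom V W) : Prop :=
  forall a : Ar, rmap V a *m f (t a) = f (s a) *m rmap W a.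

Definition iso (V W : rep) : Prop :=
  exists (f : hom V W) (g : hom W V),
    [/\ is_hom f, is_hom g &
        forall i, f i *m g i = 1%:M /\ g i *m f i = 1%:M].

Definition ses (X E Y : rep) (f : hom X E) (g : hom E Y) : Prop :=
  [/\ is_hom f, is_hom g &
      forall i, [/\ row_free (f i), row_full (g i)
                  & (f i == kermx (g i))%MS]].

Definition ext1_zero (Y X : rep) : Prop :=
  forall (E : rep) (f : hom X E) (g : hom E Y), ses f g ->
    exists r : hom E X, is_hom r /\ forall i, f i *m r i = 1%:M.

Definition summand (X Y : rep) : Prop := exists Z, iso Y (dsum X Z).

Definition in_add (M X : rep) : Prop := exists m, summand X (copies m M).

Definition indecomposable (V : rep) : Prop :=
  ~ is_zero V /\
  forall Z1 Z2, iso V (dsum Z1 Z2) -> is_zero Z1 \/ is_zero Z2.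

Definition basic (T : rep) : Prop :=
  exists Ts : seq rep,
    [/\ forall k, (k < size Ts)%N -> indecomposable (nth zero_rep Ts k),
        forall k l, (k < l < size Ts)%N ->
          ~ iso (nth zero_rep Ts k) (nth zero_rep Ts l)
      & iso T (dsum_list Ts)].

(* The path algebra A = kQ as a module: A = (+)_i P(i), where P(i) is the
   representation with basis of P(i)_j the paths from i to j and with
   P(i)_a mapping a path p to p followed by a. Paths are encoded with
   length <= n (in an acyclic quiver every path has length < n). *)
Definition PathT := {l : 'I_n.+1 & l.-tuple Ar}.
Definition pseq (x : PathT) : seq Ar := tval (tagged x).
Definition paths_set (i j : 'I_n) : {pred PathT} :=
  fun x => is_pathb i j (pseq x).

Definition proj_rep (i : 'I_n) : rep :=
  @Rep (fun j => #|paths_set i j|)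
      (fun a => \matrix_(r < #|paths_set i (s a)|, c < #|paths_set i (t a)|)
          (pseq (@enum_val _ (paths_set i (t a)) c)
             == rcons (pseq (@enum_val _ (paths_set i (s a)) r)) a)%:R).

Definition regular_rep : rep := dsum_list [seq proj_rep i | i <- enum 'I_n].

Definition projective (P : rep) : Prop := in_add regular_rep P.

Definition pd_le1 (T : rep) : Prop :=
  exists (P1 P0 : rep) (f : hom P1 P0) (g : hom P0 T),
    [/\ projective P1, projective P0 & ses f g].

Definition tilting (T : rep) : Prop :=
  [/\ pd_le1 T, ext1_zero T T &
      exists (T1 T2 : rep) (f : hom regular_rep T1) (g : hom T1 T2),
        [/\ in_add T T1, in_add T T2 & ses f g]].

Definition basic_tilting (T : rep) : Prop := basic T /\ tilting T.

Definition tq_arrow (T1 T2 : rep) : Prop :=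
  [/\ basic_tilting T1, basic_tilting T2 &
      exists M X Y M' (f : hom X M') (g : hom M' Y),
        [/\ iso T1 (dsum M X), iso T2 (dsum M Y),
            indecomposable X, indecomposable Y
          & in_add M M' /\ ses f g]].

Definition num_iso_classes (P : rep -> Prop) (c : nat) : Prop :=
  exists L : seq rep,
    [/\ size L = c,
        forall k, (k < c)%N -> P (nth zero_rep L k),
        forall k l, (k < l < c)%N -> ~ iso (nth zero_rep L k) (nth zero_rep L l)
      & forall V, P V -> exists2 k, (k < c)%N & iso V (nth zero_rep L k)].

Definition saturated (T : rep) : Prop :=
  exists sT eT : nat,
    [/\ num_iso_classes (fun T' => tq_arrow T T') sT,
        num_iso_classes (fun T' => tq_arrow T' T) eT
      & (sT + eT)%N = n].

End QuiverReps.

(* Main.v *)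
(* Write T as the sum of indecomposables X_j and let M_j be the sum of all X_k with k <> j.
   Since kQ is hereditary, Ext^1 is right exact and dim Hom - dim Ext^1 is a bilinear form in the
   dimension vectors; with the Happel-Ringel lemma (a nonzero map X -> Y of indecomposables with
   Ext^1(Y, X) = 0 is mono or epi) this makes the dimension vectors of the X_j independent, and
   Bongartz' universal extensions of projectives show that they form a basis of Z^n.
   Arrows at T correspond to the j for which X_j is cogenerated (outgoing) or generated (incoming)
   by M_j; the two are exclusive, and one of them holds iff M_j is sincere: if X_j is not generated
   by M_j, the kernel K of a left add(M_j)-approximation of X_j satisfies Ext^1(K, kQ) = 0 and
   Hom(K, M_j) = 0, so K = 0 when M_j is sincere. Hence T is saturated iff every M_j is sincere.
   If (M_j)_v = 0, expanding the unit vector e_v in the basis gives (dim X_j)_v = 1 = (dim T)_v;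
   conversely, if all M_j are sincere then (dim T)_v = (M_j)_v + (X_j)_v >= 2 for a suitable j.

   Everything is computed at the cochain level: C^0(V, W) is the space of families of linear maps
   V_i -> W_i, C^1(V, W) that of families V_(s a) -> W_(t a), Hom is the kernel and Ext^1 the
   cokernel of a derivation C^0 -> C^1, and exact sequences split in the category of graded maps. *)
Require Import Defs.
From HB Require Import structures.
From mathcomp Require Import all_boot all_order all_algebra.
From Stdlib Require Import Classical FunctionalExtensionality.
Import Defs.

Declare Scope fam_scope.
Delimit Scope fam_scope with fam.
Reserved Notation "x ** y" (at level 40, left associativity).

(** * Graded maps: families of matrices over a finite index set *)

Section Families.
Set Implicit Arguments. Unset Strict Implicit. Unset Printing Implicit Defensive.
Import GRing.Theory.
Local Open Scope ring_scope.
Variables (F : fieldType) (J : finType).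
Implicit Types p q r : J -> nat.

(** Heredity is built into the complex C^0 -> C^1: it has no C^2, so every element of C^1 is a
    cocycle and can be moved along graded sections and retractions. Hence Ext^1 is computed without
    choosing resolutions. Tilting is replaced by maximal rigidity, which counting detects: a rigid
    sum of n pairwise nonisomorphic indecomposables is maximal, since one more summand would give n
    + 1 independent dimension vectors. So an exchanged module is seen to be tilting without writing
    down its coresolution. A basis over Z, not only over Q, is required: at a vertex v where M_j
    vanishes the expansion of e_v reads a * (dim X_j)_v = 1, and only an integer a forces (dim
    X_j)_v = 1. This is the origin of the bound 2, and the reason for Bongartz' sequences, which
    write the dimension vectors of the projectives as integer combinations. Algebraic closedness
    acts through End(X) = k for rigid indecomposable X; cancellation, Krull-Schmidt and the
    uniqueness of exchanges all reduce to the question whether a scalar is zero. Incoming arrows are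
    reduced to outgoing ones over the opposite quiver. *)

Definition fidx p q : finType := {j : J & ('I_(p j) * 'I_(q j))%type}.
(** One finite function on the disjoint union of all matrix positions, instead of a dependent
    product of matrices: this gives a finite-dimensional vector space with extensional equality,
    whose dimension is a cardinality. *)
Definition fam p q := {ffun fidx p q -> F^o}.
HB.instance Definition _ p q := Vector.on (fam p q).

Definition fmx p q (x : fam p q) (j : J) : 'M[F]_(p j, q j) :=
  \matrix_(r, c) x (Tagged (fun j => ('I_(p j) * 'I_(q j))%type) (r, c)).
Definition mkfam p q (f : forall j, 'M[F]_(p j, q j)) : fam p q :=
  [ffun z => f (tag z) (tagged z).1 (tagged z).2].

Lemma mkfamE p q (f : forall j, 'M[F]_(p j, q j)) j : fmx (mkfam f) j = f j.
Proof. by apply/matrixP => r c; rewrite !mxE ffunE. Qed.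

Lemma famP p q (x y : fam p q) : (forall j, fmx x j = fmx y j) -> x = y.
Proof.
move=> H; apply/ffunP => -[j [r c]].
by have /matrixP/(_ r c) := H j; rewrite !mxE.
Qed.

Lemma fmxD p q (x y : fam p q) j : fmx (x + y) j = fmx x j + fmx y j.
Proof. by apply/matrixP => r c; rewrite !mxE ffunE. Qed.
Lemma fmxZ p q k (x : fam p q) j : fmx (k *: x) j = k *: fmx x j.
Proof. by apply/matrixP => r c; rewrite !mxE ffunE. Qed.
Lemma fmxN p q (x : fam p q) j : fmx (- x) j = - fmx x j.
Proof. by apply/matrixP => r c; rewrite !mxE ffunE. Qed.
Lemma fmx0 p q j : fmx (0 : fam p q) j = 0.
Proof. by apply/matrixP => r c; rewrite !mxE ffunE. Qed.
Definition fmxE := (mkfamE, fmxD, fmxN, fmxZ, fmx0).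

Lemma dim_fam p q : dim (fam p q) = (\sum_j p j * q j)%N.
Proof.
transitivity (#|fidx p q| * 1)%N; first by [].
rewrite muln1 card_tagged sumnE big_map big_enum /=.
by apply: eq_bigr => j _; rewrite card_prod !card_ord.
Qed.

Definition fmul p q r (x : fam p q) (y : fam q r) : fam p r :=
  mkfam (fun j => fmx x j *m fmx y j).
Definition fone p : fam p p := mkfam (fun j => 1%:M).
Local Notation "x ** y" := (fmul x y).

Lemma fmulA p q r r' (x : fam p q) (y : fam q r) (z : fam r r') :
  x ** (y ** z) = x ** y ** z.
Proof. by apply: famP => j; rewrite !fmxE mulmxA. Qed.
Lemma fmul_mid p q r r' q' (x : fam p q) (y : fam q r) (z : fam r r') (w : fam r' q') :
  x ** y ** (z ** w) = x ** (y ** z) ** w.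
Proof. by rewrite !fmulA. Qed.
Lemma fmul1 p q (x : fam p q) : fone p ** x = x.
Proof. by apply: famP => j; rewrite !fmxE mul1mx. Qed.
Lemma fmulr1 p q (x : fam p q) : x ** fone q = x.
Proof. by apply: famP => j; rewrite !fmxE mulmx1. Qed.
Lemma fmulDl p q r (x y : fam p q) (z : fam q r) : (x + y) ** z = x ** z + y ** z.
Proof. by apply: famP => j; rewrite !fmxE mulmxDl. Qed.
Lemma fmulDr p q r (z : fam p q) (x y : fam q r) : z ** (x + y) = z ** x + z ** y.
Proof. by apply: famP => j; rewrite !fmxE mulmxDr. Qed.
Lemma fmulNl p q r (x : fam p q) (z : fam q r) : (- x) ** z = - (x ** z).
Proof. by apply: famP => j; rewrite !fmxE mulNmx. Qed.
Lemma fmulNr p q r (z : fam p q) (x : fam q r) : z ** (- x) = - (z ** x).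
Proof. by apply: famP => j; rewrite !fmxE mulmxN. Qed.
Lemma fmulBl p q r (x y : fam p q) (z : fam q r) : (x - y) ** z = x ** z - y ** z.
Proof. by rewrite fmulDl fmulNl. Qed.
Lemma fmulBr p q r (z : fam p q) (x y : fam q r) : z ** (x - y) = z ** x - z ** y.
Proof. by rewrite fmulDr fmulNr. Qed.
Lemma fmulZl p q r k (x : fam p q) (z : fam q r) : (k *: x) ** z = k *: (x ** z).
Proof. by apply: famP => j; rewrite !fmxE -scalemxAl. Qed.
Lemma fmulZr p q r k (z : fam p q) (x : fam q r) : z ** (k *: x) = k *: (z ** x).
Proof. by apply: famP => j; rewrite !fmxE -scalemxAr. Qed.
Lemma fmul0 p q r (z : fam q r) : (0 : fam p q) ** z = 0.
Proof. by apply: famP => j; rewrite !fmxE mul0mx. Qed.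
Lemma fmulr0 p q r (z : fam p q) : z ** (0 : fam q r) = 0.
Proof. by apply: famP => j; rewrite !fmxE mulmx0. Qed.
Lemma fmul_suml p q r (I : Type) (s : seq I) P (x : I -> fam p q) (z : fam q r) :
  (\sum_(i <- s | P i) x i) ** z = \sum_(i <- s | P i) (x i ** z).
Proof.
apply: (big_morph (fun x => x ** z)) => [a b|]; first exact: fmulDl.
exact: fmul0.
Qed.
Lemma fmul_sumr p q r (I : Type) (s : seq I) P (x : I -> fam q r) (z : fam p q) :
  z ** (\sum_(i <- s | P i) x i) = \sum_(i <- s | P i) (z ** x i).
Proof.
apply: (big_morph (fun x => z ** x)) => [a b|]; first exact: fmulDr.
exact: fmulr0.
Qed.

Lemma fone0 p : (forall j, p j = 0%N) -> fone p = 0.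
Proof.
move=> p0; apply: famP => j; rewrite !fmxE; move: (p0 j); move: (p j) => k ->.
exact: flatmx0.
Qed.
Lemma fone_eq0 p : fone p = 0 -> forall j, p j = 0%N.
Proof.
move=> p0 j; have := congr1 (fun x => \rank (fmx x j)) p0.
by rewrite !fmxE mxrank1 mxrank0.
Qed.

(** This regularity supplies the kernels, cokernels and images below with graded complements. *)
Lemma fam_regular p q (x : fam p q) : exists y, x ** y ** x = x.
Proof.
exists (mkfam (fun j => pinvmx (fmx x j))); apply: famP => j; rewrite !fmxE.
by rewrite mulmxKpV.
Qed.

(** A rank factorization e = CR does it: cancelling C on the left and R on the right in CRCR = CR
    leaves RC = 1. *)
Lemma fam_split_idem p (e : fam p p) : e ** e = e ->
  exists q (i : fam q p) (u : fam p q), i ** u = fone q /\ u ** i = e.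
Proof.
move=> ee; exists (fun j => \rank (fmx e j)).
exists (mkfam (fun j => row_base (fmx e j))), (mkfam (fun j => col_base (fmx e j))).
split; apply: famP => j; rewrite !fmxE ?mulmx_base //.
have ej : fmx e j *m fmx e j = fmx e j by rewrite -[in RHS]ee !fmxE.
move: (row_base_free (fmx e j)) (col_base_full (fmx e j)) (mulmx_base (fmx e j)).
move: (row_base _) (col_base _) => R C Rf Cf CR.
apply: (row_free_inj Rf); apply: (row_full_inj Cf).
by rewrite mul1mx !mulmxA CR -mulmxA CR.
Qed.

Lemma fmul1C p q (x : fam p q) (y : fam q p) :
  (forall j, (q j <= p j)%N) -> x ** y = fone p -> y ** x = fone q.
Proof.
move=> le_qp xy; apply: famP => j; move/(congr1 (fun z => fmx z j)): xy.
rewrite !fmxE; move: (fmx x j) (fmx y j) (le_qp j).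
move: (p j) (q j) => a b A B le AB.
have ab : a = b.
  apply/eqP; rewrite eqn_leq le andbT -(mxrank1 F a) -AB.
  exact: leq_trans (mxrankM_maxl _ _) (rank_leq_col _).
by case: b / ab A B AB {le} => A B; exact: mulmx1C.
Qed.

Lemma fmono_le p q (x : fam p q) (y : fam q p) :
  x ** y = fone p -> forall j, (p j <= q j)%N.
Proof.
move=> xy j; move/(congr1 (fun z => \rank (fmx z j))): xy; rewrite !fmxE mxrank1 => <-.
exact: leq_trans (mxrankM_maxl _ _) (rank_leq_col _).
Qed.

End Families.
Notation "x ** y" := (fmul x y) : fam_scope.

(** * The derivation on graded maps, kernels and cokernels, and pieces of the long exact
    sequences *)

Section Calculus.
Set Implicit Arguments. Unset Strict Implicit. Unset Printing Implicit Defensive.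
Import GRing.Theory.
Local Open Scope ring_scope.
Local Open Scope fam_scope.
Variables (F : fieldType) (n : nat) (Ar : finType) (s t : Ar -> 'I_n).
Local Notation rep := (rep F s t).
Local Notation C0 V W := (fam F (rdim V) (rdim W)).
Local Notation C1 V W := (fam F (fun a => rdim V (s a)) (fun a => rdim W (t a))).
Local Notation "\1_ V" := (fone F (rdim V)) (at level 8, V at level 2).
Implicit Types U V W X Y : rep.

Definition diff V W (x : C0 V W) : C1 V W :=
  mkfam (fun a => rmap V a *m fmx x (t a) - fmx x (s a) *m rmap W a).

Fact diff_is_linear V W : linear (@diff V W).
Proof.
move=> k x y; apply: famP => a; rewrite !fmxE mulmxDr mulmxDl -scalemxAr -scalemxAl.
by rewrite scalerBr opprD addrACA.
Qed.
HB.instance Definition _ V W := GRing.isLinear.Build _ _ _ _ (@diff V W) (@diff_is_linear V W).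

Definition Hom V W : {vspace C0 V W} := lker (linfun (@diff V W)).
(** Vanishing of Ext^1(V, W), as solvability of an equation; [ext1_zeroE] identifies it with the
    splitting of all extensions. *)
Definition Ext0 V W : Prop := forall c : C1 V W, exists x : C0 V W, diff x = c.

Lemma homP V W (x : C0 V W) : reflect (diff x = 0) (x \in Hom V W).
Proof. by rewrite memv_ker lfunE; apply: eqP. Qed.

Lemma homE V W (f : hom V W) : is_hom f <-> mkfam f \in Hom V W.
Proof.
split=> [H|/homP H a].
  by apply/homP/famP => a; rewrite !fmxE H subrr.
by have := congr1 (fun z => fmx z a) H; rewrite !fmxE => /eqP; rewrite subr_eq0 => /eqP.
Qed.

Lemma fmx_hom V W (x : C0 V W) : x \in Hom V W -> is_hom (fmx x : hom V W).
Proof.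
move=> /homP H a; have := congr1 (fun z => fmx z a) H.
by rewrite !fmxE => /eqP; rewrite subr_eq0 => /eqP.
Qed.

Definition lact U V W (x : C0 U V) (c : C1 V W) : C1 U W :=
  mkfam (fun a => fmx x (s a) *m fmx c a).
Definition ract U V W (c : C1 U V) (y : C0 V W) : C1 U W :=
  mkfam (fun a => fmx c a *m fmx y (t a)).

Lemma diffM U V W (x : C0 U V) (y : C0 V W) :
  diff (x ** y) = ract (diff x) y + lact x (diff y).
Proof.
apply: famP => a; rewrite !fmxE mulmxBl mulmxBr !mulmxA addrA; congr (_ - _).
by rewrite subrK.
Qed.

Lemma lactA U V W X (x : C0 U V) (y : C0 V W) (c : C1 W X) :
  lact x (lact y c) = lact (x ** y) c.
Proof. by apply: famP => a; rewrite !fmxE mulmxA. Qed.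
Lemma ractA U V W X (c : C1 U V) (x : C0 V W) (y : C0 W X) :
  ract (ract c x) y = ract c (x ** y).
Proof. by apply: famP => a; rewrite !fmxE mulmxA. Qed.
Lemma lract U V W X (x : C0 U V) (c : C1 V W) (y : C0 W X) :
  lact x (ract c y) = ract (lact x c) y.
Proof. by apply: famP => a; rewrite !fmxE mulmxA. Qed.
Lemma lact1 U V (c : C1 U V) : lact \1_U c = c.
Proof. by apply: famP => a; rewrite !fmxE mul1mx. Qed.
Lemma ract1 U V (c : C1 U V) : ract c \1_V = c.
Proof. by apply: famP => a; rewrite !fmxE mulmx1. Qed.
Lemma lact0l U V W (c : C1 V W) : lact (0 : C0 U V) c = 0.
Proof. by apply: famP => a; rewrite !fmxE mul0mx. Qed.
Lemma ract0l U V W (y : C0 V W) : ract (0 : C1 U V) y = 0.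
Proof. by apply: famP => a; rewrite !fmxE mul0mx. Qed.
Lemma lact0r U V W (x : C0 U V) : lact x (0 : C1 V W) = 0.
Proof. by apply: famP => a; rewrite !fmxE mulmx0. Qed.
Lemma ract0r U V W (c : C1 U V) : ract c (0 : C0 V W) = 0.
Proof. by apply: famP => a; rewrite !fmxE mulmx0. Qed.
Lemma lactDr U V W (x : C0 U V) (c c' : C1 V W) : lact x (c + c') = lact x c + lact x c'.
Proof. by apply: famP => a; rewrite !fmxE mulmxDr. Qed.
Lemma lactNr U V W (x : C0 U V) (c : C1 V W) : lact x (- c) = - lact x c.
Proof. by apply: famP => a; rewrite !fmxE mulmxN. Qed.
Lemma lactDl U V W (x y : C0 U V) (c : C1 V W) : lact (x + y) c = lact x c + lact y c.
Proof. by apply: famP => a; rewrite !fmxE mulmxDl. Qed.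
Lemma lactZl U V W k (x : C0 U V) (c : C1 V W) : lact (k *: x) c = k *: lact x c.
Proof. by apply: famP => a; rewrite !fmxE scalemxAl. Qed.
Lemma ractDl U V W (c c' : C1 U V) (y : C0 V W) : ract (c + c') y = ract c y + ract c' y.
Proof. by apply: famP => a; rewrite !fmxE mulmxDl. Qed.
Lemma ractNl U V W (c : C1 U V) (y : C0 V W) : ract (- c) y = - ract c y.
Proof. by apply: famP => a; rewrite !fmxE mulNmx. Qed.
Lemma ractDr U V W (c : C1 U V) (x y : C0 V W) : ract c (x + y) = ract c x + ract c y.
Proof. by apply: famP => a; rewrite !fmxE mulmxDr. Qed.

Lemma lact_suml U V W (I : Type) (r : seq I) P (x : I -> C0 U V) (c : C1 V W) :
  lact (\sum_(i <- r | P i) x i) c = \sum_(i <- r | P i) lact (x i) c.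
Proof.
by apply: (big_morph (fun x => lact x c)) => [a b|]; [exact: lactDl | exact: lact0l].
Qed.
Lemma lact_sumr U V W (I : Type) (r : seq I) P (x : C0 U V) (c : I -> C1 V W) :
  lact x (\sum_(i <- r | P i) c i) = \sum_(i <- r | P i) lact x (c i).
Proof.
by apply: (big_morph (lact x)) => [a b|]; [exact: lactDr | exact: lact0r].
Qed.
Lemma ract_sumr U V W (I : Type) (r : seq I) P (c : C1 U V) (x : I -> C0 V W) :
  ract c (\sum_(i <- r | P i) x i) = \sum_(i <- r | P i) ract c (x i).
Proof.
by apply: (big_morph (ract c)) => [a b|]; [exact: ractDr | exact: ract0r].
Qed.

Lemma diffMl U V W (x : C0 U V) (y : C0 V W) :
  y \in Hom V W -> diff (x ** y) = ract (diff x) y.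
Proof. by move=> /homP yH; rewrite diffM yH lact0r addr0. Qed.
Lemma diffMr U V W (x : C0 U V) (y : C0 V W) :
  x \in Hom U V -> diff (x ** y) = lact x (diff y).
Proof. by move=> /homP xH; rewrite diffM xH ract0l add0r. Qed.

Lemma hom1 V : \1_V \in Hom V V.
Proof. by apply/homP/famP => a; rewrite !fmxE mul1mx mulmx1 subrr. Qed.
Lemma homM U V W (x : C0 U V) (y : C0 V W) :
  x \in Hom U V -> y \in Hom V W -> x ** y \in Hom U W.
Proof. by move=> /homP xH yH; apply/homP; rewrite diffMl // xH ract0l. Qed.

Lemma hom_cancelr U V W (x : C0 U V) (i : C0 V W) (u : C0 W V) :
  i \in Hom V W -> i ** u = \1_V -> x ** i \in Hom U W -> x \in Hom U V.
Proof.
move=> iH iu /homP; rewrite diffMl // => H; apply/homP.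
by rewrite -[diff x]ract1 -iu -ractA H ract0l.
Qed.
Lemma hom_cancell U V W (x : C0 V W) (p : C0 U V) (u : C0 V U) :
  p \in Hom U V -> u ** p = \1_V -> p ** x \in Hom U W -> x \in Hom V W.
Proof.
move=> pH up /homP; rewrite diffMr // => H; apply/homP.
by rewrite -[diff x]lact1 -up -lactA H lact0r.
Qed.

(** The idempotent is merely graded. [lact e (diff e) = 0] says that its image is a
    subrepresentation, and [ract (diff e) e = 0] that its kernel is one. The maps of S are
    compressed from those of V, so S is the subrepresentation in the first case and the quotient in
    the second. *)
Lemma split_idem V (e : C0 V V) : e ** e = e ->
  exists (S : rep) (i : C0 S V) (u : C0 V S),
    [/\ i ** u = \1_S, u ** i = e, lact e (diff e) = 0 -> i \in Hom S V
      & ract (diff e) e = 0 -> u \in Hom V S].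
Proof.
move=> ee; have [q [i [u [iu ui]]]] := fam_split_idem ee.
pose S : rep := @Rep F n Ar s t q (fun a => fmx i (s a) *m rmap V a *m fmx u (t a)).
exists S, i, u.
have fE (z : C0 V V) : z ** z = z -> forall j, fmx z j *m fmx z j = fmx z j.
  by move=> zz j; rewrite -[in RHS]zz fmxE.
have {fE} eeE := fE _ ee.
have iuE j : fmx i j *m fmx u j = 1%:M by move/(congr1 (fun z => fmx z j)): iu; rewrite !fmxE.
have uiE j : fmx u j *m fmx i j = fmx e j by rewrite -ui mkfamE.
split=> // [/(congr1 (fun z => fmx z _)) H|/(congr1 (fun z => fmx z _)) H];
  apply/homP/famP => a; move: {H}(H a); rewrite !fmxE.
- rewrite mulmxBr !mulmxA eeE => /eqP; rewrite subr_eq0 => /eqP.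
  move/(congr1 (mulmx (fmx i (s a)))); rewrite -[fmx e (s a)]uiE !mulmxA !iuE !mul1mx => H.
  by rewrite -(mulmxA _ (fmx u _)) uiE H subrr.
rewrite mulmxBl -!mulmxA eeE => /eqP; rewrite subr_eq0 => /eqP.
move/(congr1 (mulmxr (fmx u (t a)))); rewrite /= -[fmx e (t a)]uiE -!mulmxA !iuE !mulmx1 => H.
by rewrite /= {1}H -uiE !mulmxA subrr.
Qed.

Definition exact X E Y (f : C0 X E) (g : C0 E Y) : Prop :=
  [/\ f \in Hom X E, g \in Hom E Y & exists f' g',
    [/\ f ** f' = \1_X, g' ** g = \1_Y, f ** g = 0 & f' ** f + g ** g' = \1_E]].

(** The one-sided inverse is a graded map, so the condition is injectivity at each vertex and not
    splitting; likewise for [epi]. *)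
Definition mono U V (x : C0 U V) := x \in Hom U V /\ exists y, x ** y = \1_U.
Definition epi U V (x : C0 U V) := x \in Hom U V /\ exists y, y ** x = \1_V.

(** With a pseudo-inverse f' of f, the idempotent 1 - f f' has image ker f. In the same way 1 - f' f
    below has kernel im f, and f' f projects onto im f. *)
Lemma hom_ker V W (f : C0 V W) : f \in Hom V W ->
  exists K (i : C0 K V) (u : C0 V K) (f' : C0 W V),
    [/\ i \in Hom K V, i ** u = \1_K, i ** f = 0 & u ** i + f ** f' = \1_V].
Proof.
move=> fH; have [f' ff'f] := fam_regular f.
pose e := \1_V - f ** f'.
have ef : e ** f = 0 by rewrite fmulBl fmul1 ff'f subrr.
have ee : e ** e = e by rewrite {2}/e fmulBr fmulr1 fmulA ef fmul0 subr0.
have [K [i [u [iu ui iH _]]]] := split_idem ee.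
exists K, i, u, f'; split=> //.
- apply: iH; rewrite {2}/e linearB /= (homP _ (hom1 V)) sub0r diffMr //.
  by rewrite lactNr lactA ef lact0l oppr0.
- by rewrite -[i]fmul1 -iu -(fmulA i) ui -(fmulA i) ef fmulr0.
by rewrite ui subrK.
Qed.

Lemma hom_coker V W (f : C0 V W) : f \in Hom V W ->
  exists Y (g : C0 W Y) (v : C0 Y W) (f' : C0 W V),
    [/\ g \in Hom W Y, v ** g = \1_Y, f ** g = 0 & f' ** f + g ** v = \1_W].
Proof.
move=> fH; have [f' ff'f] := fam_regular f.
pose e := \1_W - f' ** f.
have fe : f ** e = 0 by rewrite fmulBr fmulr1 fmulA ff'f subrr.
have ee : e ** e = e by rewrite {1}/e fmulBl fmul1 -fmulA fe fmulr0 subr0.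
have [Y [v [g [vg gv _ gH]]]] := split_idem ee.
exists Y, g, v, f'; split=> //.
- apply: gH; rewrite {1}/e linearB /= (homP _ (hom1 W)) sub0r diffMl //.
  by rewrite ractNl ractA fe ract0r oppr0.
- by rewrite -[g]fmulr1 -vg !fmulA -(fmulA f) gv fe fmul0.
by rewrite gv addrC subrK.
Qed.

Lemma hom_image V W (f : C0 V W) : f \in Hom V W ->
  exists I (p : C0 V I) (i : C0 I W), [/\ epi p, mono i & p ** i = f].
Proof.
move=> fH; have [f' ff'f] := fam_regular f.
pose e := f' ** f.
have fe : f ** e = f by rewrite fmulA ff'f.
have ee : e ** e = e by rewrite {1}/e -fmulA fe.
have [I [i [u [iu ui iH _]]]] := split_idem ee.
have {}iH : i \in Hom I W.
  apply: iH; have : diff (f ** e) = 0 by rewrite fe; apply/homP.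
  by rewrite diffMr // => H; rewrite -[lact e _]lactA H lact0r.
have puE : f ** u ** i = f by rewrite -fmulA ui fe.
have pH : f ** u \in Hom V I by apply: hom_cancelr iH iu _; rewrite puE.
exists I, (f ** u), i; split=> //; last by split=> //; exists u.
split=> //; exists (i ** f').
by rewrite fmulA -(fmulA i) -/e -ui fmulA iu fmul1 iu.
Qed.

Lemma mono_exact X E (f : C0 X E) : mono f -> exists Y (g : C0 E Y), exact f g.
Proof.
move=> [fH [f0 ff0]]; have [Y [g [v [f' [gH vg fg H]]]]] := hom_coker fH.
exists Y, g; split=> //; exists f', v; split=> //.
have : f ** f' ** f = f.
  by rewrite -[RHS]fmulr1 -H fmulDr !fmulA fg fmul0 addr0.
by move/(congr1 (fun z => z ** f0)); rewrite -fmulA ff0 fmulr1.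
Qed.

Lemma epi_exact E Y (g : C0 E Y) : epi g -> exists X (f : C0 X E), exact f g.
Proof.
move=> [gH [g0 g0g]]; have [X [f [u [g' [fH fu fg H]]]]] := hom_ker gH.
exists X, f; split=> //; exists u, g'; split=> //.
have : g ** g' ** g = g.
  have -> : g ** g' = \1_E - u ** f by rewrite -H [_ + g ** g']addrC addrK.
  by rewrite fmulBl -fmulA fg fmulr0 subr0 fmul1.
by move/(congr1 (fun z => g0 ** z)); rewrite !fmulA g0g fmul1.
Qed.

Lemma exact_mono X E Y (f : C0 X E) (g : C0 E Y) : exact f g -> mono f.
Proof. by case=> fH _ [f' [g' [H _ _ _]]]; split=> //; exists f'. Qed.
Lemma exact_epi X E Y (f : C0 X E) (g : C0 E Y) : exact f g -> epi g.
Proof. by case=> _ gH [f' [g' [_ H _ _]]]; split=> //; exists g'. Qed.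

Lemma mono_inj U V W (i : C0 V W) (x y : C0 U V) : mono i -> x ** i = y ** i -> x = y.
Proof.
by move=> [_ [u iu]] /(congr1 (fun z => z ** u)); rewrite -!fmulA iu !fmulr1.
Qed.
Lemma epi_inj U V W (p : C0 U V) (x y : C0 V W) : epi p -> p ** x = p ** y -> x = y.
Proof.
by move=> [_ [u up]] /(congr1 (fun z => u ** z)); rewrite !fmulA up !fmul1.
Qed.

Lemma exact_lift U X E Y (f : C0 X E) (g : C0 E Y) (x : C0 U E) :
  exact f g -> x \in Hom U E -> x ** g = 0 -> exists2 y, y \in Hom U X & y ** f = x.
Proof.
move=> fg xH xg; have [fH gH [f' [g' [ff' g'g fg0 H]]]] := fg.
have yx : x ** f' ** f = x.
  by rewrite -[RHS]fmulr1 -H fmulDr !fmulA xg fmul0 addr0.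
by exists (x ** f') => //; apply: (hom_cancelr fH ff'); rewrite yx.
Qed.
Lemma exact_desc U X E Y (f : C0 X E) (g : C0 E Y) (x : C0 E U) :
  exact f g -> x \in Hom E U -> f ** x = 0 -> exists2 y, y \in Hom Y U & g ** y = x.
Proof.
move=> fg xH xg; have [fH gH [f' [g' [ff' g'g fg0 H]]]] := fg.
have yx : g ** (g' ** x) = x.
  by rewrite -[RHS]fmul1 -H fmulDl -!fmulA xg fmulr0 add0r.
by exists (g' ** x) => //; apply: (hom_cancell gH g'g); rewrite yx.
Qed.

(** Heredity: the cochain [ract c g'], lifted along a graded section, is again a cocycle because
    there is no condition in degree 2. *)
Lemma Ext0_epi V W W' (g : C0 W W') : epi g -> Ext0 V W -> Ext0 V W'.
Proof.
move=> [gH [g' g'g]] VW c; have [x dx] := VW (ract c g').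
by exists (x ** g); rewrite diffMl // dx ractA g'g ract1.
Qed.
Lemma Ext0_mono V V' W (f : C0 V' V) : mono f -> Ext0 V W -> Ext0 V' W.
Proof.
move=> [fH [f' ff']] VW c; have [x dx] := VW (lact f' c).
by exists (f ** x); rewrite diffMr // dx lactA ff' lact1.
Qed.

(* The cocycle c, representing the extension, measures the failure of the graded section g'
   and of the graded retraction f' to be homomorphisms. *)
Lemma exact_class X E Y (f : C0 X E) (g : C0 E Y) (f' : C0 E X) (g' : C0 Y E) :
  f \in Hom X E -> g \in Hom E Y -> f ** f' = \1_X -> g' ** g = \1_Y -> f ** g = 0 ->
  f' ** f + g ** g' = \1_E ->
  exists c : C1 Y X, diff g' = ract c f /\ diff f' = - lact g c.
Proof.
move=> fH gH ff' g'g fg H; exists (ract (diff g') f').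
have dg : ract (ract (diff g') f') f = diff g'.
  rewrite -[RHS]ract1 -H ractDr ractA -(ractA _ g) -[ract (diff g') g]diffMl // g'g.
  by rewrite (homP _ (hom1 Y)) ract0l addr0.
split=> //; have := congr1 (@diff E E) H.
rewrite linearD /= (homP _ (hom1 E)) diffMl // diffMr // => /eqP.
rewrite addr_eq0 => /eqP df.
rewrite -[LHS]ract1 -ff' -ractA df ractNl; congr (- _).
by rewrite lract.
Qed.

(** The graded extension f' h of h has differential -g c h. As Ext^1(Y, W) = 0, the pushed-out
    cocycle c h bounds some x, and g x is the correction. *)
Lemma exact_extend X E Y W (f : C0 X E) (g : C0 E Y) (h : C0 X W) :
  exact f g -> Ext0 Y W -> h \in Hom X W -> exists2 h', h' \in Hom E W & f ** h' = h.
Proof.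
move=> [fH gH [f' [g' [ff' g'g fg H]]]] YW hH.
have [c [dg df]] := exact_class fH gH ff' g'g fg H.
have [x dx] := YW (ract c h).
exists (f' ** h + g ** x); last first.
  by rewrite fmulDr !fmulA ff' fg fmul0 addr0 fmul1.
apply/homP; rewrite linearD /= diffMl // diffMr // df dx ractNl lract addrC subrr //.
Qed.
Lemma exact_colift X E Y W (f : C0 X E) (g : C0 E Y) (h : C0 W Y) :
  exact f g -> Ext0 W X -> h \in Hom W Y -> exists2 h', h' \in Hom W E & h' ** g = h.
Proof.
move=> [fH gH [f' [g' [ff' g'g fg H]]]] WX hH.
have [c [dg df]] := exact_class fH gH ff' g'g fg H.
have [x dx] := WX (lact h c).
exists (h ** g' - x ** f); last first.
  by rewrite fmulBl -!fmulA g'g fg fmulr0 subr0 fmulr1.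
by apply/homP; rewrite linearB /= (diffMr g' hH) (diffMl x fH) dg dx lract subrr.
Qed.

(** Extendability of all maps X -> W makes the connecting map vanish, so Ext^1(Y, W) embeds into
    Ext^1(E, W). *)
Lemma exact_Ext0_coker X E Y W (f : C0 X E) (g : C0 E Y) :
  exact f g -> Ext0 E W ->
  (forall h, h \in Hom X W -> exists2 h', h' \in Hom E W & f ** h' = h) -> Ext0 Y W.
Proof.
move=> [fH gH [f' [g' [ff' g'g fg H]]]] EW ext c.
have [x dx] := EW (lact g c).
have fxH : f ** x \in Hom X W.
  by apply/homP; rewrite diffMr // dx lactA fg lact0l.
have [h hH hE] := ext _ fxH.
exists (g' ** (x - h)); have gK : g ** (g' ** (x - h)) = x - h.
  rewrite -[RHS]fmul1 -H fmulDl -!(fmulA _ _ (x - h)).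
  by rewrite (fmulBr f) hE subrr fmulr0 add0r.
have : diff (g ** (g' ** (x - h))) = lact g c by rewrite gK linearB /= (homP _ hH) subr0.
rewrite diffMr // => /(congr1 (lact g')).
by rewrite !lactA g'g !lact1.
Qed.
Lemma exact_Ext0_ker X E Y W (f : C0 X E) (g : C0 E Y) :
  exact f g -> Ext0 W E ->
  (forall h, h \in Hom W Y -> exists2 h', h' \in Hom W E & h' ** g = h) -> Ext0 W X.
Proof.
move=> [fH gH [f' [g' [ff' g'g fg H]]]] EW ext c.
have [x dx] := EW (ract c f).
have xgH : x ** g \in Hom W Y.
  by apply/homP; rewrite diffMl // dx ractA fg ract0r.
have [h hH hE] := ext _ xgH.
exists ((x - h) ** f'); have fK : (x - h) ** f' ** f = x - h.
  rewrite -[RHS]fmulr1 -H fmulDr !fmulA.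
  by rewrite (fmulBl _ _ g) hE subrr fmul0 addr0.
have : diff ((x - h) ** f' ** f) = ract c f by rewrite fK linearB /= (homP _ hH) subr0.
rewrite diffMl // => /(congr1 (fun z => ract z f')).
by rewrite !ractA ff' !ract1.
Qed.

Lemma exact_Ext0_midl X E Y W (f : C0 X E) (g : C0 E Y) :
  exact f g -> Ext0 X W -> Ext0 Y W -> Ext0 E W.
Proof.
move=> [fH gH [f' [g' [ff' g'g fg H]]]] XW YW c.
have [x dx] := XW (lact f c).
(* Subtracting a coboundary makes c vanish on X; what is left is pulled back from Y along g. *)
have : lact f (c - diff (f' ** x)) = 0.
  by rewrite lactDr lactNr -diffMr // fmulA ff' fmul1 dx subrr.
set b := c - _ => fb.
have [y dy] := YW (lact g' b).
exists (f' ** x + g ** y); rewrite linearD /= (diffMr y gH) dy lactA.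
have -> : lact (g ** g') b = b.
  by rewrite -[RHS]lact1 -H lactDl -[lact (f' ** f) b]lactA fb lact0r add0r.
by rewrite addrC subrK.
Qed.
Lemma exact_Ext0_midr X E Y W (f : C0 X E) (g : C0 E Y) :
  exact f g -> Ext0 W X -> Ext0 W Y -> Ext0 W E.
Proof.
move=> [fH gH [f' [g' [ff' g'g fg H]]]] WX WY c.
have [y dy] := WY (ract c g).
have : ract (c - diff (y ** g')) g = 0.
  by rewrite ractDl ractNl -diffMl // -fmulA g'g fmulr1 dy subrr.
set b := c - _ => bg.
have [x dx] := WX (ract b f').
exists (y ** g' + x ** f); rewrite linearD /= (diffMl x fH) dx ractA.
have -> : ract b (f' ** f) = b.
  by rewrite -[RHS]ract1 -H ractDr -[ract b (g ** g')]ractA bg ract0l addr0.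
by rewrite addrC subrK.
Qed.

End Calculus.

(** * Homomorphisms, isomorphisms and binary direct sums *)

Section Homs.
Set Implicit Arguments. Unset Strict Implicit. Unset Printing Implicit Defensive.
Import GRing.Theory.
Local Open Scope ring_scope.
Local Open Scope fam_scope.
Variables (F : fieldType) (n : nat) (Ar : finType) (s t : Ar -> 'I_n).
Local Notation rep := (rep F s t).
Local Notation C0 V W := (fam F (rdim V) (rdim W)).
Local Notation C1 V W := (fam F (fun a => rdim V (s a)) (fun a => rdim W (t a))).
Local Notation "\1_ V" := (fone F (rdim V)) (at level 8, V at level 2).
Implicit Types U V W X Y Z M : rep.

Lemma hom0 V W : 0 \in Hom V W. Proof. exact: mem0v. Qed.
Lemma homD V W (x y : C0 V W) : x \in Hom V W -> y \in Hom V W -> x + y \in Hom V W.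
Proof. exact: rpredD. Qed.
Lemma hom_sum V W (I : Type) (r : seq I) (P : pred I) (x : I -> C0 V W) :
  (forall i, P i -> x i \in Hom V W) -> \sum_(i <- r | P i) x i \in Hom V W.
Proof. exact: rpred_sum. Qed.

Lemma isoE V W : iso V W <-> exists x y,
  [/\ x \in Hom V W, y \in Hom W V, x ** y = \1_V & y ** x = \1_W].
Proof.
split=> [[f [g [/homE fH /homE gH fg]]]|[x [y [xH yH xy yx]]]].
  exists (mkfam f), (mkfam g); split=> //; apply: famP => j;
  by rewrite !fmxE; case: (fg j).
exists (fmx x), (fmx y); split; try exact: fmx_hom.
by move=> i; move: (congr1 (fun z => fmx z i) xy) (congr1 (fun z => fmx z i) yx); rewrite !fmxE.
Qed.

Lemma iso_refl V : iso V V.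
Proof. by apply/isoE; exists \1_V, \1_V; rewrite !hom1 fmul1. Qed.
Lemma iso_sym V W : iso V W -> iso W V.
Proof. by move=> /isoE [x [y [? ? ? ?]]]; apply/isoE; exists y, x. Qed.
Lemma iso_trans U V W : iso U V -> iso V W -> iso U W.
Proof.
move=> /isoE [x [x' [? ? e1 e2]]] /isoE [y [y' [? ? e3 e4]]].
apply/isoE; exists (x ** y), (y' ** x').
rewrite !homM //; split=> //.
  by rewrite -fmulA [y ** _]fmulA e3 fmul1.
by rewrite -fmulA [x' ** _]fmulA e2 fmul1.
Qed.

Lemma is_zeroE V : is_zero V <-> \1_V = 0.
Proof. by split; [exact: fone0 | exact: fone_eq0]. Qed.

Definition inl V W : C0 V (dsum V W) := mkfam (fun j => row_mx 1%:M 0).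
Definition inr V W : C0 W (dsum V W) := mkfam (fun j => row_mx 0 1%:M).
Definition prl V W : C0 (dsum V W) V := mkfam (fun j => col_mx 1%:M 0).
Definition prr V W : C0 (dsum V W) W := mkfam (fun j => col_mx 0 1%:M).

Lemma inl_prl V W : inl V W ** prl V W = \1_V.
Proof. by apply: famP => j; rewrite !fmxE mul_row_col mul1mx mul0mx addr0. Qed.
Lemma inr_prr V W : inr V W ** prr V W = \1_W.
Proof. by apply: famP => j; rewrite !fmxE mul_row_col mul1mx mul0mx add0r. Qed.
Lemma inl_prr V W : inl V W ** prr V W = 0.
Proof. by apply: famP => j; rewrite !fmxE mul_row_col mul1mx mul0mx addr0. Qed.
Lemma inr_prl V W : inr V W ** prl V W = 0.
Proof. by apply: famP => j; rewrite !fmxE mul_row_col mul1mx mul0mx add0r. Qed.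
Lemma dsum1 V W : prl V W ** inl V W + prr V W ** inr V W = \1_(dsum V W).
Proof.
apply: famP => j; rewrite !fmxE !mul_col_row !(mul0mx, mulmx0, mul1mx).
by rewrite add_block_mx !addr0 !add0r -scalar_mx_block.
Qed.
Lemma inl_hom V W : inl V W \in Hom V (dsum V W).
Proof.
apply/homP/famP => a; rewrite !fmxE /= mul_row_block mul_mx_row.
by rewrite !(mul0mx, mulmx0, mul1mx, mulmx1) addr0 add0r subrr.
Qed.
Lemma inr_hom V W : inr V W \in Hom W (dsum V W).
Proof.
apply/homP/famP => a; rewrite !fmxE /= mul_row_block mul_mx_row.
by rewrite !(mul0mx, mulmx0, mul1mx, mulmx1) addr0 add0r subrr.
Qed.
Lemma prl_hom V W : prl V W \in Hom (dsum V W) V.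
Proof.
apply/homP/famP => a; rewrite !fmxE /= mul_block_col mul_col_mx.
by rewrite !(mul0mx, mulmx0, mul1mx, mulmx1) addr0 add0r subrr.
Qed.
Lemma prr_hom V W : prr V W \in Hom (dsum V W) W.
Proof.
apply/homP/famP => a; rewrite !fmxE /= mul_block_col mul_col_mx.
by rewrite !(mul0mx, mulmx0, mul1mx, mulmx1) addr0 add0r subrr.
Qed.
Lemma homZ V W k (x : C0 V W) : x \in Hom V W -> k *: x \in Hom V W.
Proof. exact: rpredZ. Qed.
Lemma homN V W (x : C0 V W) : x \in Hom V W -> - x \in Hom V W.
Proof. by move=> H; rewrite rpredN. Qed.

End Homs.

Ltac homt := try solve [intros; repeat first [assumption | done
 | lazymatch goal with
   | |- is_true (fmul _ _ \in _) => apply: homM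
   | |- is_true ((_ + _)%R \in _) => apply: homD
   | |- is_true ((- _)%R \in _) => apply: homN
   | |- is_true ((_ *: _)%R \in _) => apply: homZ
   | |- is_true (0%R \in _) => apply: hom0
   | |- is_true (fone _ _ \in _) => apply: hom1
   | |- is_true (inl _ _ \in _) => apply: inl_hom
   | |- is_true (inr _ _ \in _) => apply: inr_hom
   | |- is_true (prl _ _ \in _) => apply: prl_hom
   | |- is_true (prr _ _ \in _) => apply: prr_hom
   end
 | match goal with H : forall j, _ |- _ => apply: H end]].

(** * Summands, additive closures and finite direct sums *)

Section Sums.
Set Implicit Arguments. Unset Strict Implicit. Unset Printing Implicit Defensive.
Import GRing.Theory.
Local Open Scope ring_scope.
Local Open Scope fam_scope.
Variables (F : fieldType) (n : nat) (Ar : finType) (s t : Ar -> 'I_n).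
Local Notation rep := (rep F s t).
Local Notation C0 V W := (fam F (rdim V) (rdim W)).
Local Notation C1 V W := (fam F (fun a => rdim V (s a)) (fun a => rdim W (t a))).
Local Notation "\1_ V" := (fone F (rdim V)) (at level 8, V at level 2).
Implicit Types U V W X Y Z M : rep.

Lemma dsum_exact V W : exact (inl V W) (prr V W).
Proof.
split; homt; exists (prl V W), (inr V W).
by rewrite inl_prl inr_prr inl_prr dsum1.
Qed.

Lemma split_iso V X Z (x : C0 X V) (y : C0 V X) (i : C0 Z V) (u : C0 V Z) :
  x \in Hom X V -> y \in Hom V X -> i \in Hom Z V -> u \in Hom V Z ->
  x ** y = \1_X -> i ** u = \1_Z -> x ** u = 0 -> i ** y = 0 -> y ** x + u ** i = \1_V ->
  iso V (dsum X Z).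
Proof.
move=> xH yH iH uH xy iu xu iy xyiu; apply/isoE.
exists (y ** inl X Z + u ** inr X Z), (prl X Z ** x + prr X Z ** i); split; homt.
  rewrite fmulDl !fmulDr !fmul_mid inl_prl inl_prr inr_prl inr_prr.
  by rewrite !(fmulr1, fmulr0, fmul0) add0r addr0.
rewrite fmulDl !fmulDr !fmul_mid xy xu iy iu.
by rewrite !(fmulr1, fmulr0, fmul0) add0r addr0 dsum1.
Qed.

Lemma split_compl V X (x : C0 X V) (y : C0 V X) :
  x \in Hom X V -> y \in Hom V X -> x ** y = \1_X ->
  exists Z (i : C0 Z V) (u : C0 V Z),
   [/\ i \in Hom Z V, u \in Hom V Z, i ** u = \1_Z, x ** u = 0
     & i ** y = 0 /\ y ** x + u ** i = \1_V].
Proof.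
move=> xH yH xy; pose e := \1_V - y ** x.
have eH : e \in Hom V V by rewrite /e; homt.
have ey : e ** y = 0 by rewrite fmulBl fmul1 -fmulA xy fmulr1 subrr.
have xe : x ** e = 0 by rewrite fmulBr fmulr1 fmulA xy fmul1 subrr.
have ee : e ** e = e by rewrite {2}/e fmulBr fmulr1 fmulA ey fmul0 subr0.
have [Z [i [u [iu ui iH uH]]]] := split_idem ee.
exists Z, i, u; split.
- by apply: iH; rewrite (homP _ eH) lact0r.
- by apply: uH; rewrite (homP _ eH) ract0l.
- by [].
- by rewrite -[u]fmulr1 -iu !fmulA -(fmulA x) ui xe fmul0.
split; last by rewrite ui addrC subrK.
by rewrite -[i]fmul1 -iu -!fmulA (fmulA u) ui ey !fmulr0.
Qed.

Lemma split_summand V X (x : C0 X V) (y : C0 V X) :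
  x \in Hom X V -> y \in Hom V X -> x ** y = \1_X -> summand X V.
Proof.
move=> xH yH xy; have [Z [i [u [? ? ? ? [? ?]]]]] := split_compl xH yH xy.
by exists Z; apply: (@split_iso _ _ _ x y i u).
Qed.

Lemma summand_split V X : summand X V -> exists x y,
  [/\ x \in Hom X V, y \in Hom V X & x ** y = \1_X].
Proof.
move=> [Z /isoE [f [g [fH gH fg gf]]]].
exists (inl X Z ** g), (f ** prl X Z); split; homt.
by rewrite -fmulA (fmulA g) gf fmul1 inl_prl.
Qed.

Definition fac M U W (x : C0 U W) : Prop :=
  exists m (u : 'I_m -> C0 U M) (v : 'I_m -> C0 M W),
    [/\ forall i, u i \in Hom U M, forall i, v i \in Hom M W & x = \sum_i u i ** v i].

Lemma fac_comp M U W (u : C0 U M) (v : C0 M W) :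
  u \in Hom U M -> v \in Hom M W -> fac M (u ** v).
Proof.
by move=> uH vH; exists 1%N, (fun=> u), (fun=> v); split=> //; rewrite big_ord1.
Qed.
Lemma fac0 M U W : fac M (0 : C0 U W).
Proof. by exists 0%N, (fun=> 0), (fun=> 0); split; homt; rewrite big_ord0. Qed.
Lemma facD M U W (x y : C0 U W) : fac M x -> fac M y -> fac M (x + y).
Proof.
move=> [m [u [v [uH vH ->]]]] [m' [u' [v' [uH' vH' ->]]]].
exists (m + m')%N, (fun i => match split i with Datatypes.inl j => u j | Datatypes.inr j => u' j end).
exists (fun i => match split i with Datatypes.inl j => v j | Datatypes.inr j => v' j end).
split=> [i|i|]; [by case: split | by case: split |].
rewrite big_split_ord; congr (_ + _); apply: eq_bigr => i _.
  by rewrite -[lshift _ _]/(unsplit (Datatypes.inl _)) unsplitK.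
by rewrite -[rshift _ _]/(unsplit (Datatypes.inr _)) unsplitK.
Qed.
Lemma fac_mull M U V W (x : C0 U V) (y : C0 V W) : x \in Hom U V -> fac M y -> fac M (x ** y).
Proof.
move=> xH [m [u [v [uH vH ->]]]]; exists m, (fun i => x ** u i), v; split; homt.
by rewrite fmul_sumr; apply: eq_bigr => i _; rewrite fmulA.
Qed.
Lemma fac_mulr M U V W (x : C0 U V) (y : C0 V W) : y \in Hom V W -> fac M x -> fac M (x ** y).
Proof.
move=> xH [m [u [v [uH vH ->]]]]; exists m, u, (fun i => v i ** y); split; homt.
by rewrite fmul_suml; apply: eq_bigr => i _; rewrite fmulA.
Qed.
Lemma fac_sum M U W (I : Type) (r : seq I) (P : pred I) (x : I -> C0 U W) :
  (forall i, P i -> fac M (x i)) -> fac M (\sum_(i <- r | P i) x i).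
Proof.
move=> H; elim/big_ind: _ => //; [exact: fac0 | exact: facD].
Qed.

(* Membership in add M as a condition on the ideal of maps factoring through powers of M; it is
   equivalent to in_add by in_addE. *)
Definition adds M X : Prop := fac M \1_X.

Lemma fac_trans M N U W (x : C0 U W) : adds M N -> fac N x -> fac M x.
Proof.
move=> MN [m [u [v [uH vH ->]]]]; apply: fac_sum => i _.
by rewrite -[u i]fmulr1 -fmulA; apply: fac_mull; homt; apply: fac_mulr; homt.
Qed.
Lemma fac_adds M N U (u : C0 U N) : adds M N -> u \in Hom U N -> fac M u.
Proof. by move=> MN uH; rewrite -[u]fmulr1; apply: fac_mull. Qed.
Lemma adds_refl M : adds M M.
Proof. by rewrite /adds -[\1_M]fmul1; apply: fac_comp; homt. Qed.
Lemma adds_trans M N X : adds M N -> adds N X -> adds M X.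
Proof. exact: fac_trans. Qed.
Lemma adds_split M N X (x : C0 X N) (y : C0 N X) :
  x \in Hom X N -> y \in Hom N X -> x ** y = \1_X -> adds M N -> adds M X.
Proof. by move=> xH yH xy MN; rewrite /adds -xy; apply: fac_mulr => //; apply: fac_adds. Qed.
Lemma adds_iso M N X : iso N X -> adds M N -> adds M X.
Proof. by move=> /isoE [x [y [xH yH xy yx]]]; apply: (@adds_split _ _ _ y x). Qed.
Lemma adds_zero M X : \1_X = 0 -> adds M X.
Proof. by rewrite /adds => ->; exact: fac0. Qed.
Lemma adds_dsum M X Y : adds M X -> adds M Y -> adds M (dsum X Y).
Proof.
move=> MX MY; rewrite /adds -dsum1; apply: facD; apply: fac_mulr; homt;
apply: fac_adds; homt.
Qed.
Lemma adds_dsuml X Y : adds (dsum X Y) X.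
Proof. exact: (adds_split (inl_hom X Y) (prl_hom X Y) (inl_prl X Y) (adds_refl _)). Qed.
Lemma adds_dsumr X Y : adds (dsum X Y) Y.
Proof. exact: (adds_split (inr_hom X Y) (prr_hom X Y) (inr_prr X Y) (adds_refl _)). Qed.

Lemma copies_sum m U M W (u : 'I_m -> C0 U M) (v : 'I_m -> C0 M W) :
  (forall i, u i \in Hom U M) -> (forall i, v i \in Hom M W) ->
  exists (x : C0 U (copies m M)) (y : C0 (copies m M) W),
   [/\ x \in Hom U (copies m M), y \in Hom (copies m M) W & x ** y = \sum_i u i ** v i].
Proof.
elim: m u v => [|m IH] u v uH vH.
  by exists 0, 0; split; homt; rewrite fmul0 big_ord0.
have [x [y [xH yH xy]]] := IH (fun i => u (lift ord0 i)) (fun i => v (lift ord0 i))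
   (fun i => uH _) (fun i => vH _).
exists (u ord0 ** inl M (copies m M) + x ** inr M (copies m M)).
exists (prl M (copies m M) ** v ord0 + prr M (copies m M) ** y).
split; homt.
rewrite fmulDl !fmulDr !fmul_mid.
rewrite inl_prl inl_prr inr_prl inr_prr !(fmulr1, fmulr0, fmul0) add0r addr0 xy.
by rewrite big_ord_recl.
Qed.

Lemma adds_copies M m : adds M (copies m M).
Proof.
elim: m => [|m IH]; last exact: adds_dsum (adds_refl _) _.
by apply: adds_zero; apply/is_zeroE.
Qed.

Lemma in_addE M X : in_add M X <-> adds M X.
Proof.
split=> [[m /summand_split [x [y [xH yH xy]]]]|].
  exact: adds_split xH yH xy (adds_copies M m).
move=> [m [u [v [uH vH e]]]]; exists m.
have [x [y [xH yH xy]]] := copies_sum uH vH.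
by apply: (split_summand xH yH); rewrite xy.
Qed.

Lemma Ext0_adds_l M X W : adds M X -> Ext0 M W -> Ext0 X W.
Proof.
move=> [m [u [v [uH vH e]]]] MW c.
have [|x xE] := @fin_all_exists _ _ (fun i x => diff x = lact (v i) c).
  by move=> i; apply: MW.
exists (\sum_i u i ** x i); rewrite linear_sum /= -[RHS]lact1 e lact_suml.
by apply: eq_bigr => i _; rewrite diffMr // xE lactA.
Qed.
Lemma Ext0_adds_r M X W : adds M X -> Ext0 W M -> Ext0 W X.
Proof.
move=> [m [u [v [uH vH e]]]] MW c.
have [|x xE] := @fin_all_exists _ _ (fun i x => diff x = ract c (u i)).
  by move=> i; apply: MW.
exists (\sum_i x i ** v i); rewrite linear_sum /= -[RHS]ract1 e ract_sumr.
by apply: eq_bigr => i _; rewrite diffMl // xE ractA.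
Qed.
Lemma Ext0_adds M X Y : adds M X -> adds M Y -> Ext0 M M -> Ext0 X Y.
Proof. by move=> MX MY /(Ext0_adds_l MX) /(Ext0_adds_r MY). Qed.
Lemma Ext0_dsuml X Y W : Ext0 X W -> Ext0 Y W -> Ext0 (dsum X Y) W.
Proof. exact: exact_Ext0_midl (dsum_exact X Y). Qed.
Lemma Ext0_dsumr X Y W : Ext0 W X -> Ext0 W Y -> Ext0 W (dsum X Y).
Proof. exact: exact_Ext0_midr (dsum_exact X Y). Qed.

(* Identity when b holds and V, W have the same dimensions; lets families indexed
   by a finite type be handled without transports. *)
Definition delta (b : bool) V W : C0 V W :=
  mkfam (fun j => \matrix_(r, c) (b && (r == c :> nat))%:R).
Lemma delta_true V : delta true V V = \1_V.
Proof. by apply: famP => j; rewrite !fmxE; apply/matrixP => r c; rewrite !mxE. Qed.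
Lemma delta_false V W : delta false V W = 0.
Proof. by apply: famP => j; rewrite !fmxE; apply/matrixP => r c; rewrite !mxE. Qed.
Lemma delta_hom (J : eqType) (X : J -> rep) i j : delta (i == j) (X i) (X j) \in Hom (X i) (X j).
Proof. by case: eqP => [->|_]; rewrite ?delta_true ?delta_false; homt. Qed.

(** The structure maps are indexed by all of J and vanish outside r. Orthogonality then holds for
    all pairs of distinct indices without membership conditions, which keeps the induction on r
    uniform. *)
Record biproduct (J : eqType) (r : seq J) (X : J -> rep) (B : rep)
    (i : forall j, C0 (X j) B) (p : forall j, C0 B (X j)) : Prop := Biproduct {
  bi_inH : forall j, i j \in Hom (X j) B;
  bi_prH : forall j, p j \in Hom B (X j);
  bi_out : forall j, j \notin r -> i j = 0 /\ p j = 0;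
  bi_diag : forall j, j \in r -> i j ** p j = \1_(X j);
  bi_off : forall j k, j != k -> i j ** p k = 0;
  bi_one : \sum_(j <- r) p j ** i j = \1_B }.

Lemma dsum_list_biproduct (J : eqType) (r : seq J) (X : J -> rep) : uniq r ->
  exists i p, @biproduct J r X (dsum_list [seq X j | j <- r]) i p.
Proof.
elim: r => [|a r IH] /=.
  exists (fun=> 0), (fun=> 0); split; homt.
    by move=> j k _; rewrite fmul0.
  by rewrite big_nil; apply/esym/is_zeroE.
move=> /andP [ar ur]; have [i [p [iH pH out diag off one]]] := IH ur.
set B := dsum_list _ in i p iH pH out diag off one *.
have dd j k : delta (j == a) (X j) (X a) ** delta (a == k) (X a) (X k) =
              delta ((j == a) && (a == k)) (X j) (X k).
  have [->|_] := eqVneq j a; last by rewrite !delta_false fmul0.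
  have [->|_] := eqVneq a k; last by rewrite !delta_false fmulr0.
  by rewrite delta_true fmul1.
have [ia pa] := out _ ar.
exists (fun j => delta (j == a) (X j) (X a) ** inl (X a) B + i j ** inr (X a) B).
exists (fun j => prl (X a) B ** delta (a == j) (X a) (X j) + prr (X a) B ** p j).
have prodE j k : (delta (j == a) (X j) (X a) ** inl (X a) B + i j ** inr (X a) B) **
  (prl (X a) B ** delta (a == k) (X a) (X k) + prr (X a) B ** p k) =
   delta ((j == a) && (a == k)) (X j) (X k) + i j ** p k.
  rewrite fmulDl !fmulDr !fmul_mid.
  rewrite inl_prl inl_prr inr_prl inr_prr !(fmulr1, fmulr0, fmul0) add0r addr0.
  by rewrite dd.
split.
- by move=> j; apply: homD; homt; apply: homM; homt; exact: delta_hom.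
- by move=> j; apply: homD; homt; apply: homM; homt; exact: delta_hom.
- move=> j; rewrite inE negb_or => /andP [ja /out [-> ->]].
  by rewrite [a == j]eq_sym (negbTE ja) !delta_false !(fmul0, fmulr0) !add0r.
- move=> j; rewrite inE prodE => /orP [/eqP -> | jr].
    by rewrite ia fmul0 eqxx delta_true addr0.
  have ja : j != a by apply: contraNneq ar => <-.
  by rewrite (negbTE ja) delta_false add0r diag.
- move=> j k jk; rewrite prodE off // addr0.
  have -> : (j == a) && (a == k) = false; last exact: delta_false.
  by apply/negbTE; apply: contra jk => /andP [/eqP -> /eqP ->].
rewrite big_cons ia pa eqxx !delta_true !(fmul0, fmulr0, fmul1, fmulr1) !addr0.
rewrite -dsum1 -[in RHS](fmul1 (inr (X a) B)) -one; congr (_ + _).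
rewrite fmul_suml fmul_sumr; apply: eq_big_seq => j jr.
have ja : j != a by apply: contraNneq ar => <-.
by rewrite [a == j]eq_sym (negbTE ja) !delta_false !(fmul0, fmulr0) !add0r !fmulA.
Qed.

Lemma biproduct_iso (J : eqType) (r : seq J) (X : J -> rep) B B' i p i' p' :
  @biproduct J r X B i p -> @biproduct J r X B' i' p' -> uniq r -> iso B B'.
Proof.
move=> [iH pH out diag off one] [iH' pH' out' diag' off' one'] ur; apply/isoE.
have H (C D : rep) (q : forall j, C0 C (X j)) (v : forall j, C0 (X j) C) (u : forall j, C0 (X j) D) (w : forall j, C0 D (X j)) :
  (forall j, j \in r -> u j ** w j = \1_(X j)) -> (forall j k, j != k -> u j ** w k = 0) ->
  \sum_(j <- r) q j ** v j = \1_C ->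
  (\sum_(j <- r) q j ** u j) ** (\sum_(k <- r) w k ** v k) = \1_C.
  move=> uw1 uw0 <-; rewrite fmul_suml; apply: eq_big_seq => j jr.
  rewrite -fmulA fmul_sumr (bigD1_seq j) //= big1_seq => [|k /andP [kj _]].
    by rewrite addr0 (fmulA (u j)) uw1 // fmul1.
  by rewrite fmulA uw0 ?fmul0 // eq_sym.
exists (\sum_(j <- r) p j ** i' j), (\sum_(j <- r) p' j ** i j); split.
- by apply: hom_sum => j _; homt.
- by apply: hom_sum => j _; homt.
- exact: H.
- exact: H.
Qed.

Lemma biproduct_transfer (J : eqType) (r : seq J) (X : J -> rep) B B' i p :
  @biproduct J r X B i p -> iso B B' -> exists i' p', @biproduct J r X B' i' p'.
Proof.
move=> [iH pH out diag off one] /isoE [x [y [xH yH xy yx]]].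
exists (fun j => i j ** x), (fun j => y ** p j); split=> [j|j|j jr|j jr|j k jk|]; homt.
- by have [-> ->] := out j jr; rewrite fmul0 fmulr0.
- by rewrite -fmulA (fmulA x) xy fmul1 diag.
- by rewrite -fmulA (fmulA x) xy fmul1 off.
rewrite -yx -[x in RHS]fmul1 -one fmul_suml fmul_sumr.
by apply: eq_bigr => j _; rewrite !fmulA.
Qed.

Lemma biproduct_perm (J : eqType) (r r' : seq J) (X : J -> rep) B i p :
  perm_eq r r' -> @biproduct J r X B i p -> @biproduct J r' X B i p.
Proof.
move=> rr' [iH pH out diag off one]; split=> // [j|j|].
- by rewrite -(perm_mem rr'); apply: out.
- by rewrite -(perm_mem rr'); apply: diag.
- by rewrite -(perm_big _ rr').
Qed.

Lemma dsum_list_iso (J : eqType) (r r' : seq J) (X : J -> rep) : uniq r -> perm_eq r r' ->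
  iso (dsum_list [seq X j | j <- r]) (dsum_list [seq X j | j <- r']).
Proof.
move=> ur rr'; have ur' : uniq r' by rewrite -(perm_uniq rr').
have [i [p B]] := dsum_list_biproduct X ur.
have [i' [p' B']] := dsum_list_biproduct X ur'.
exact: biproduct_iso (biproduct_perm rr' B) B' ur'.
Qed.

Lemma adds_biproduct (J : eqType) (r : seq J) (X : J -> rep) B i p j :
  @biproduct J r X B i p -> j \in r -> adds B (X j).
Proof.
move=> [iH pH out diag off one] jr.
exact: adds_split (iH j) (pH j) (diag j jr) (adds_refl _).
Qed.

Lemma adds_dsum_list (J : eqType) (r : seq J) (X : J -> rep) M :
  (forall j, j \in r -> adds M (X j)) -> adds M (dsum_list [seq X j | j <- r]).
Proof.
elim: r => [|a r IH] H /=; first by apply: adds_zero; apply/is_zeroE.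
apply: adds_dsum; first by apply: H; rewrite inE eqxx.
by apply: IH => j jr; apply: H; rewrite inE jr orbT.
Qed.

Lemma indec_neq0 V : indecomposable V -> \1_V <> 0.
Proof. by move=> [nz _] /is_zeroE. Qed.

Lemma indec_split V X (x : C0 X V) (y : C0 V X) : indecomposable V ->
  x \in Hom X V -> y \in Hom V X -> x ** y = \1_X -> \1_X <> 0 -> y ** x = \1_V.
Proof.
move=> [_ ind] xH yH xy X0.
have [Z [i [u [iH uH iu xu [iy e]]]]] := split_compl xH yH xy.
have [/is_zeroE //|/is_zeroE Z0] := ind X Z (split_iso xH yH iH uH xy iu xu iy e).
by rewrite -e -[u]fmulr1 Z0 fmulr0 fmul0 addr0.
Qed.

Lemma indec_summand V X (x : C0 X V) (y : C0 V X) : indecomposable V ->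
  x \in Hom X V -> y \in Hom V X -> x ** y = \1_X -> \1_X <> 0 -> iso X V.
Proof.
move=> indV xH yH xy X0; apply/isoE; exists x, y; split=> //.
exact: indec_split indV xH yH xy X0.
Qed.

Lemma indec_intro V : \1_V <> 0 ->
  (forall Z1 Z2 (i1 : C0 Z1 V) (p1 : C0 V Z1) (i2 : C0 Z2 V) (p2 : C0 V Z2),
     i1 \in Hom Z1 V -> p1 \in Hom V Z1 -> i2 \in Hom Z2 V -> p2 \in Hom V Z2 ->
     i1 ** p1 = \1_Z1 -> i2 ** p2 = \1_Z2 -> i2 ** p1 = 0 -> 
     \1_Z1 = 0 \/ \1_Z2 = 0) -> indecomposable V.
Proof.
move=> V0 H; split=> [/is_zeroE //|Z1 Z2 /isoE [x [y [xH yH xy yx]]]].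
rewrite !is_zeroE; apply: (H _ _ (inl Z1 Z2 ** y) (x ** prl Z1 Z2) (inr Z1 Z2 ** y) (x ** prr Z1 Z2)); homt.
- by rewrite -fmulA (fmulA y) yx fmul1 inl_prl.
- by rewrite -fmulA (fmulA y) yx fmul1 inr_prr.
- by rewrite -fmulA (fmulA y) yx fmul1 inr_prl.
Qed.

Lemma iso_dim V W : iso V W -> rdim V =1 rdim W.
Proof.
move=> /isoE [x [y [_ _ xy yx]]] j.
by apply/eqP; rewrite eqn_leq (fmono_le xy) (fmono_le yx).
Qed.

End Sums.

(** * Fitting's lemma, the Happel-Ringel lemma and the Euler form *)

Section Fitting.
Set Implicit Arguments. Unset Strict Implicit. Unset Printing Implicit Defensive.
Import GRing.Theory Num.Theory Order.TTheory.
Local Open Scope ring_scope.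
Local Open Scope fam_scope.
Variables (F : fieldType) (n : nat) (Ar : finType) (s t : Ar -> 'I_n).
Local Notation rep := (rep F s t).
Local Notation C0 V W := (fam F (rdim V) (rdim W)).
Local Notation C1 V W := (fam F (fun a => rdim V (s a)) (fun a => rdim W (t a))).
Local Notation "\1_ V" := (fone F (rdim V)) (at level 8, V at level 2).
Implicit Types U V W X Y Z M : rep.

Definition isom V W (x : C0 V W) : Prop :=
  x \in Hom V W /\ exists y, [/\ y \in Hom W V, x ** y = \1_V & y ** x = \1_W].

Lemma isom_iso V W (x : C0 V W) : isom x -> iso V W.
Proof. by move=> [xH [y [? ? ?]]]; apply/isoE; exists x, y. Qed.

Lemma mono_isom V W (x : C0 V W) : mono x -> (forall j, rdim W j <= rdim V j)%N -> isom x.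
Proof.
move=> [xH [y xy]] le; have yx := fmul1C le xy.
by split=> //; exists y; split=> //; apply: (hom_cancelr xH xy); rewrite yx hom1.
Qed.
Lemma epi_isom V W (x : C0 V W) : epi x -> (forall j, rdim V j <= rdim W j)%N -> isom x.
Proof.
move=> [xH [y yx]] le; have xy := fmul1C le yx.
by split=> //; exists y; split=> //; apply: (hom_cancelr xH xy); rewrite yx hom1.
Qed.

Definition tdim V : nat := (\sum_j rdim V j)%N.

Lemma sum_leq_eq (I : finType) (f g : I -> nat) : (forall i, f i <= g i)%N ->
  (\sum_i g i <= \sum_i f i)%N -> forall i, (g i <= f i)%N.
Proof.
move=> fg le i; rewrite leqNgt; apply: contraL le => lt; rewrite -ltnNge.
rewrite (bigD1 i) //= [X in (_ < X)%N](bigD1 i) //= -addSn leq_add //.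
exact: leq_sum.
Qed.

Lemma mono_tdim_isom V W (x : C0 V W) : mono x -> (tdim W <= tdim V)%N -> isom x.
Proof.
move=> mx le; apply: mono_isom => //; apply: sum_leq_eq le => j.
by have [_ [y xy]] := mx; apply: (fmono_le xy).
Qed.
Lemma epi_tdim_isom V W (x : C0 V W) : epi x -> (tdim V <= tdim W)%N -> isom x.
Proof.
move=> mx le; apply: epi_isom => //; apply: sum_leq_eq le => j.
by have [_ [y xy]] := mx; apply: (fmono_le xy).
Qed.

Lemma tdim0 V : tdim V = 0%N -> \1_V = 0.
Proof.
move/eqP; rewrite sum_nat_eq0 => /forallP H; apply: fone0 => j.
by have /eqP := H j.
Qed.
Lemma tdim_dsum V W : tdim (dsum V W) = (tdim V + tdim W)%N.
Proof. by rewrite /tdim -big_split. Qed.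
Lemma tdim_iso V W : iso V W -> tdim V = tdim W.
Proof. by move=> /iso_dim H; apply: eq_bigr. Qed.
Lemma tdim_gt0 V : \1_V <> 0 -> (0 < tdim V)%N.
Proof. by move=> H; rewrite lt0n; apply/eqP => /tdim0. Qed.

Fixpoint fpow V (e : C0 V V) m : C0 V V := if m is m'.+1 then e ** fpow e m' else \1_V.

Lemma fpow_hom V (e : C0 V V) m : e \in Hom V V -> fpow e m \in Hom V V.
Proof. by move=> eH; elim: m => [|m IH] /=; homt. Qed.
Lemma fpowD V (e : C0 V V) m m' : fpow e (m + m') = fpow e m ** fpow e m'.
Proof. by elim: m => [|m IH] /=; rewrite ?fmul1 // IH fmulA. Qed.

Definition frank V W (x : C0 V W) : nat := (\sum_j \rank (fmx x j))%N.

(** If the rank of e^m still drops on squaring, m is doubled; the total rank falls each time, so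
    this stops. *)
Lemma fpow_stable V (e : C0 V V) :
  exists2 m, (0 < m)%N & (frank (fpow e m) <= frank (fpow e m ** fpow e m))%N.
Proof.
suff H N : forall m, (0 < m)%N -> (frank (fpow e m) <= N)%N ->
  exists2 m, (0 < m)%N & (frank (fpow e m) <= frank (fpow e m ** fpow e m))%N.
  exact: (H _ 1%N isT (leqnn _)).
elim: N => [|N IH] m m0 le.
  by exists m => //; exact: leq_trans le (leq0n _).
have [?|lt] := leqP (frank (fpow e m)) (frank (fpow e m ** fpow e m)); first by exists m.
apply: (IH (m + m)%N); first by rewrite addn_gt0 m0.
by rewrite fpowD -ltnS; exact: leq_trans lt le.
Qed.

(** For g = e^m of stable rank, the image of g is a direct summand of X, hence 0 or X. In the first
    case e is nilpotent and 1 + e invertible, in the second e is invertible. *)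
Lemma fitting X (e : C0 X X) : indecomposable X -> e \in Hom X X ->
  isom e \/ isom (\1_X + e).
Proof.
move=> indX eH; have [m m0 le] := fpow_stable e.
set g := fpow e m in le; have gH : g \in Hom X X by apply: fpow_hom.
have [I [p [i [[pH [p' pp]] [iH [i' ii]] pi]]]] := hom_image gH.
(* [i ** p] is the restriction of g to its image I; the choice of m keeps its rank full. *)
have [ipH [z [zH ipz zip]]] : isom (i ** p).
  apply: mono_isom => //; split; homt.
  have full j : (rdim I j <= \rank (fmx (i ** p) j))%N.
    move: j; apply: sum_leq_eq => [j|]; first exact: rank_leq_row.
    apply: (@leq_trans (frank g)).
      apply: leq_sum => j _; rewrite -(mxrank1 F (rdim I j)).
      have := congr1 (fun x => fmx x j) (_ : p' ** g ** i' = \1_I).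
      rewrite !fmxE => <-; last by rewrite -pi fmulA pp fmul1 ii.
      exact: leq_trans (mxrankM_maxl _ _) (mxrankM_maxr _ _).
    apply: leq_trans le _; apply: leq_sum => j _.
    have -> : g ** g = p ** (i ** p) ** i by rewrite -pi !fmulA.
    by rewrite !fmxE; exact: leq_trans (mxrankM_maxl _ _) (mxrankM_maxr _ _).
  exists (mkfam (fun j => pinvmx (fmx (i ** p) j))); apply: famP => j.
  by move: (full j); move: (i ** p) => A Aj; rewrite !fmxE mulmxVp -?row_leq_rank.
case: (classic (\1_I = 0)) => [I0|I0].
  have g0 : g = 0 by rewrite -pi -[p]fmulr1 I0 fmulr0 fmul0.
  right; apply: mono_isom => //; split; homt.
  have eeH : \1_X + e \in Hom X X by homt.
  have [K [k [u [f' [kH ku k0 uk]]]]] := hom_ker eeH.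
  exists f'; rewrite -[RHS]uk; suff -> : k = 0 by rewrite fmulr0 add0r.
  (* On the kernel of 1 + e the map e is -1, so e^m acts there by a sign; but e^m = 0. *)
  have ke : k ** e = - k by move/eqP: k0; rewrite fmulDr fmulr1 addrC addr_eq0 => /eqP.
  have kpow l : k ** fpow e l = (-1) ^+ l *: k.
    elim: l => [|l IH] /=; first by rewrite fmulr1 scale1r.
    by rewrite fmulA ke fmulNl IH exprS mulN1r scaleNr.
  have := kpow m; rewrite -/g g0 fmulr0 => /esym/eqP.
  by rewrite scaler_eq0 signr_eq0 => /eqP.
left; apply: mono_isom => //; split=> //.
have xy : i ** (p ** z) = \1_I by rewrite fmulA.
have yx : p ** z ** i = \1_X by apply: (indec_split indX iH _ xy I0); homt.
case: m m0 @g {le} gH pi => // m _ g gH pi.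
exists (fpow e m ** (p ** z) ** (z ** i)); rewrite !fmulA -[e ** _]/g -pi.
by rewrite -(fmulA p i p) -(fmulA p (i ** p)) ipz fmulr1 yx.
Qed.

(** Factor f as p : X -> I followed by i : I -> Y, with cokernel g : Y -> C of i. The class of this
    sequence lifts along p to C^1(C, X), and its pullback to Y bounds some y since Ext^1(Y, X) = 0.
    Then i y : I -> X and y p + i' : Y -> I are homomorphisms. Fitting's lemma for the endomorphism
    p i y of X makes p mono, or else I a summand of Y. *)
Lemma happel_ringel X Y (f : C0 X Y) : indecomposable X -> indecomposable Y ->
  Ext0 Y X -> f \in Hom X Y -> f <> 0 -> mono f \/ epi f.
Proof.
move=> indX indY YX fH f0.
have [I [p [i [[pH [p' pp]] im pi]]]] := hom_image fH.
have [C [g [iH gH [i' [g' [ii gg ig e]]]]]] := mono_exact im.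
have [c [dg di]] := exact_class iH gH ii gg ig e.
have [y dy] := YX (lact g (ract c p')).
have iyH : i ** y \in Hom I X by apply/homP; rewrite diffMr // dy lactA ig lact0l.
have wH : y ** p + i' \in Hom Y I.
  by apply/homP; rewrite linearD /= diffMl // dy di lract ractA pp ract1 subrr.
have [[_ [v [vH zv vz]]]|[_ [v [vH zv vz]]]] := fitting indX (homM pH iyH).
  left; split=> //; exists (i' ** (i ** y ** v)).
  by rewrite -pi !fmulA -(fmulA p i i') ii fmulr1 -zv !fmulA.
right; split=> //.
(* If v inverts 1 + p (i y), then 1 - (i y) v p inverts 1 + (i y) p, which is i followed by y p +
   i'. *)
pose k := \1_I - i ** y ** v ** p.
have kH : k \in Hom I I by rewrite /k; homt.
have ik : i ** ((y ** p + i') ** k) = \1_I.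
  rewrite fmulA fmulDr ii /k fmulBr fmulr1 fmulDl fmul1.
  have /(congr1 (fun z => i ** y ** z ** p)) := zv.
  rewrite fmulr1 fmulDl fmul1 fmulDr fmulDl !fmulA => H.
  by rewrite (addrC (i ** y ** p ** i ** y ** v ** p)) H addrAC subrr add0r.
have I0 : \1_I <> 0 by move=> I0; apply: f0; rewrite -pi -[p]fmulr1 I0 fmulr0 fmul0.
exists ((y ** p + i') ** k ** p'); rewrite -pi fmulA -(fmulA _ p') pp fmulr1.
by apply: (indec_split indY iH _ ik I0); homt.
Qed.

Definition hdim V W : nat := \dim (Hom V W).

Lemma dim_C1 V W : dim (C1 V W) = (\sum_a rdim V (s a) * rdim W (t a))%N.
Proof. exact: dim_fam. Qed.

Lemma Ext0P V W : Ext0 V W <-> limg (linfun (@diff _ _ _ s t V W)) = fullv.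
Proof.
split=> [H|H c].
  apply/eqP; rewrite eqEsubv subvf; apply/subvP => c _.
  by have [x <-] := H c; apply/memv_imgP; exists x; rewrite ?memvf ?lfunE.
have : c \in limg (linfun (@diff _ _ _ s t V W)) by rewrite H memvf.
by move=> /memv_imgP [x _ ->]; exists x; rewrite lfunE.
Qed.

Lemma euler_le V W : (\sum_j rdim V j * rdim W j
  <= hdim V W + \sum_a rdim V (s a) * rdim W (t a))%N.
Proof.
rewrite -dim_C1 -(dim_fam F) -dimvf -(limg_ker_dim (linfun (@diff _ _ _ s t V W)) fullv).
by rewrite capfv leq_add2l -dimvf dimvS ?subvf.
Qed.
(** Rank-nullity for [diff]. Read from right to left it proves the vanishing of Ext^1 by a dimension
    count, as is done for the projectives. *)
Lemma euler_Ext0 V W : Ext0 V W <-> (\sum_j rdim V j * rdim W j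
  = hdim V W + \sum_a rdim V (s a) * rdim W (t a))%N.
Proof.
rewrite Ext0P -dim_C1 -(dim_fam F) -dimvf -(limg_ker_dim (linfun (@diff _ _ _ s t V W)) fullv).
rewrite capfv -[in X in _ <-> X]dimvf; split=> [->|/addnI H] //.
by apply/eqP; rewrite eqEdim subvf /= H. Qed.

Definition euler V W : rat :=
  \sum_j (rdim V j)%:R * (rdim W j)%:R - \sum_a (rdim V (s a))%:R * (rdim W (t a))%:R.
Lemma eulerE V W : Ext0 V W -> euler V W = (hdim V W)%:R.
Proof.
move=> /euler_Ext0 H; apply/eqP; rewrite subr_eq; apply/eqP.
move/(congr1 (fun m => m%:R : rat)): H; rewrite natrD !natr_sum.
by under eq_bigr do rewrite natrM; under [in X in _ = X -> _]eq_bigr do rewrite natrM.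
Qed.

Lemma hdim_eq0 V W : hdim V W = 0%N -> forall x, x \in Hom V W -> x = 0.
Proof. by move/eqP; rewrite dimv_eq0 => /eqP -> x; rewrite memv0 => /eqP. Qed.
Lemma hdim0 V W : (forall x, x \in Hom V W -> x = 0) -> hdim V W = 0%N.
Proof.
move=> H; apply/eqP; rewrite dimv_eq0 -subv0; apply/subvP => x /H ->; exact: mem0v.
Qed.

(** * Families of pairwise nonisomorphic, mutually Ext-orthogonal indecomposables *)

Section ExceptionalFamily.
Variables (J : finType) (X : J -> rep).
Hypotheses (indX : forall j, indecomposable (X j)) (isoX : forall i j, i != j -> ~ iso (X i) (X j)).
Hypothesis (rigX : forall i j, Ext0 (X i) (X j)).

Lemma mono_lt i j (x : C0 (X i) (X j)) : i != j -> mono x -> (tdim (X i) < tdim (X j))%N.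
Proof.
move=> ij mx; rewrite ltnNge; apply/negP => le; apply: (isoX ij).
exact: isom_iso (mono_tdim_isom mx le).
Qed.
Lemma epi_lt i j (x : C0 (X i) (X j)) : i != j -> epi x -> (tdim (X j) < tdim (X i))%N.
Proof.
move=> ij mx; rewrite ltnNge; apply/negP => le; apply: (isoX ij).
exact: isom_iso (epi_tdim_isom mx le).
Qed.

(** The composite is nonzero, hence mono or epi; then the epi x is also mono, or the mono y is also
    epi, against the strict inequalities of dimensions. *)
Lemma no_epi_mono h i j (x : C0 (X h) (X i)) (y : C0 (X i) (X j)) :
  h != i -> i != j -> epi x -> mono y -> False.
Proof.
move=> hi ij ex my; have [xH [x' xx]] := ex; have [yH [y' yy]] := my.
have xy0 : x ** y <> 0.
  move/(congr1 (fun z => x' ** z ** y')); rewrite !fmulA xx fmul1 yy fmulr0 fmul0.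
  exact: indec_neq0.
have [[_ [w xyw]]|[_ [w xyw]]] := happel_ringel (indX h) (indX j) (@rigX _ _) (homM xH yH) xy0.
  have mx : mono x by split=> //; exists (y ** w); rewrite fmulA.
  by have := ltn_trans (mono_lt hi mx) (epi_lt hi ex); rewrite ltnn.
have ey : epi y by split=> //; exists (w ** x); rewrite -fmulA.
by have := ltn_trans (mono_lt ij my) (epi_lt ij ey); rewrite ltnn.
Qed.

(** Otherwise nonzero maps between distinct members of S could be continued backwards forever, each
    mono or epi. Before a mono only a mono can stand, and its source is smaller, so monos do not
    occur; before an epi the dimensions then grow beyond every bound, while S is finite. *)
Lemma hom_sink (S : {set J}) : S != set0 ->
  exists2 j, j \in S & forall i, i \in S -> i != j -> forall x, x \in Hom (X i) (X j) -> x = 0.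
Proof.
move=> /set0Pn [j0 j0S]; apply: NNPP => H.
have pred j : j \in S -> exists i, i \in S /\ i != j /\ exists x, x \in Hom (X i) (X j) /\ x <> 0.
  move=> jS; apply: NNPP => H2; apply: H; exists j => // i iS ij x xH.
  by apply: NNPP => x0; apply: H2; exists i; do 2!split=> //; exists x.
have noM N : forall i j (x : C0 (X i) (X j)), i \in S -> i != j -> mono x ->
    (tdim (X i) <= N)%N -> False.
  elim: N => [|N IH] i j x iS ij mx le; have [h [hS [hi [z [zH z0]]]]] := pred i iS;
    have [mz|ez] := happel_ringel (indX h) (indX i) (@rigX _ _) zH z0;
    try exact: no_epi_mono hi ij ez mx.
    by have := leq_trans (mono_lt hi mz) le.
  by apply: (IH _ _ z hS hi mz); rewrite -ltnS; exact: leq_trans (mono_lt hi mz) le.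
have big k : exists2 j, j \in S & (k <= tdim (X j))%N.
  elim: k => [|k [j jS le]]; first by exists j0.
  have [i [iS [ij [x [xH x0]]]]] := pred j jS; exists i => //.
  have [mx|ex] := happel_ringel (indX i) (indX j) (@rigX _ _) xH x0.
    by case: (noM _ _ _ x iS ij mx (leqnn _)).
  exact: leq_ltn_trans le (epi_lt ij ex).
have [j jS] := big (\sum_j tdim (X j)).+1.
by rewrite (bigD1 j) //= ltnNge leq_addr.
Qed.

(** Pair the relation by the Euler form with X_j, where j is a sink of the support of a: only a_j
    dim End(X_j) survives. *)
Lemma dim_independent (a : J -> rat) :
  (forall v, \sum_j a j * (rdim (X j) v)%:R = 0) -> forall j, a j = 0.
Proof.
move=> H j1; apply/eqP; apply: contraT => aj1.
have [|j] := @hom_sink [set j | a j != 0]; first by apply/set0Pn; exists j1; rewrite inE.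
rewrite inE => aj sink.
have : \sum_i a i * euler (X i) (X j) = 0.
  under eq_bigr => i _ do rewrite mulrBr !mulr_sumr.
  rewrite sumrB exchange_big [X in _ - X]exchange_big /=.
  rewrite !big1 ?subrr // => v _.
    under eq_bigr => i _ do rewrite mulrA.
    by rewrite -mulr_suml H mul0r.
  under eq_bigr => i _ do rewrite mulrA.
  by rewrite -mulr_suml H mul0r.
rewrite (bigD1 j) //= big1 => [|i ij]; last first.
  have [->|ai] := eqVneq (a i) 0; first by rewrite mul0r.
  by rewrite eulerE // (hdim0 (sink i _ ij)) ?mulr0 // inE.
rewrite addr0 => /eqP; rewrite mulf_eq0 (negbTE aj) /= eulerE // pnatr_eq0 => /eqP h0.
by case: (indec_neq0 (indX j)); apply: (hdim_eq0 h0); rewrite hom1.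
Qed.

Lemma card_le_n : (#|J| <= n)%N.
Proof.
pose A := \matrix_(i < #|J|, v < n) ((rdim (X (enum_val i)) v)%:R : rat).
suff : row_free A by rewrite -row_leq_rank => /leq_trans -> //; exact: rank_leq_col.
apply: inj_row_free => u uA; apply/rowP => i; rewrite mxE.
rewrite -[i]enum_valK; apply: (dim_independent (a := fun j => u 0 (enum_rank j))) => v.
move/rowP: uA => /(_ v); rewrite !mxE => uA; rewrite -[RHS]uA.
rewrite (reindex (fun i : 'I_#|J| => enum_val i)) /=; last first.
  by apply: onW_bij; apply: enum_val_bij.
by apply: eq_bigr => k _; rewrite mxE enum_valK.
Qed.

End ExceptionalFamily.
End Fitting.

(** * Endomorphisms over an algebraically closed field *)

Section ClosedField.
Set Implicit Arguments. Unset Strict Implicit. Unset Printing Implicit Defensive.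
Import GRing.Theory.
Local Open Scope ring_scope.
Local Open Scope fam_scope.
Variables (F : closedFieldType) (n : nat) (Ar : finType) (s t : Ar -> 'I_n).

(** Let k be an eigenvalue of f at a vertex of the support. If f - k were nonzero, the Happel-Ringel
    lemma with X = Y would make it mono or epi, hence invertible at that vertex. *)
Lemma End_scalar (X : rep F s t) (f : fam F (rdim X) (rdim X)) : indecomposable X ->
  Ext0 X X -> f \in Hom X X -> exists k, f = k *: fone F (rdim X).
Proof.
move=> indX XX fH.
have [j Xj] : exists j, rdim X j != 0%N.
  apply: NNPP => H; case: (indX) => + _; apply => j; apply/eqP.
  by apply: contraT => Xj; case: H; exists j.
have [k rk] : exists k, root (char_poly (fmx f j)) k.
  by apply/closed_rootP; rewrite size_char_poly.
exists k; apply/eqP; rewrite -subr_eq0; apply/eqP; apply: NNPP => f0.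
have fkH : f - k *: fone F (rdim X) \in Hom X X by homt.
have sing : \rank (fmx (f - k *: fone F (rdim X)) j) <> rdim X j.
  move: rk; rewrite -eigenvalue_root_char /eigenvalue /eigenspace kermx_eq0 -row_leq_rank.
  by rewrite !fmxE scalemx1 => /negP rk e; apply: rk; rewrite e.
have [[_ [y e]]|[_ [y e]]] := happel_ringel indX indX XX fkH f0; apply: sing; apply/eqP;
  rewrite eqn_leq rank_leq_row -[X in (X <= _)%N](mxrank1 F);
  have := congr1 (fun z => fmx z j) e; rewrite [LHS]mkfamE [RHS]mkfamE => <-.
  exact: mxrankM_maxl.
exact: mxrankM_maxr.
Qed.
End ClosedField.

(** * Paths and the indecomposable projectives *)

Section Projectives.
Set Implicit Arguments. Unset Strict Implicit. Unset Printing Implicit Defensive.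
Import GRing.Theory.
Local Open Scope ring_scope.
Local Open Scope fam_scope.
Variables (F : fieldType) (n : nat) (Ar : finType) (s t : Ar -> 'I_n).
Local Notation rep := (rep F s t).
Local Notation C0 V W := (fam F (rdim V) (rdim W)).
Local Notation C1 V W := (fam F (fun a => rdim V (s a)) (fun a => rdim W (t a))).
Local Notation "\1_ V" := (fone F (rdim V)) (at level 8, V at level 2).
Implicit Types U V W X Y Z M P E : rep.

Lemma is_pathb_rcons i j p a :
  is_pathb s t i j (rcons p a) = is_pathb s t i (s a) p && (t a == j).
Proof.
by elim: p i => [|b p IH] i /=; [rewrite eq_sym | rewrite IH andbA].
Qed.

Lemma is_pathb_cat i j p q :
  is_pathb s t i j (p ++ q) -> exists2 k, is_pathb s t i k p & is_pathb s t k j q.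
Proof.
elim: p i => [|a p IH] i /=; first by exists i.
by move=> /andP [-> /IH [k pk kq]]; exists k.
Qed.

Hypothesis hQ : acyclic s t.

(** A repeated vertex would cut a nonempty closed path out of p. *)
Lemma path_uniq i j p : is_pathb s t i j p -> uniq (i :: map t p).
Proof.
elim: p i => [|a p IH] i // /andP [/eqP si pj].
rewrite cons_uniq IH // andbT; apply/negP => /mapP [b bp ib].
have [q [r e]] : exists q r, a :: p = rcons q b ++ r.
  by case/splitPr: bp => p1 p2; exists p1, p2; rewrite cat_rcons.
have := is_pathb_cat (_ : is_pathb s t i j (rcons q b ++ r)).
rewrite -e /= si eqxx => /(_ pj) [k].
rewrite is_pathb_rcons => /andP [qb /eqP bk] _.
have : is_pathb s t i i (rcons q b) by rewrite is_pathb_rcons qb ib eqxx.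
by move=> /hQ; case: (q).
Qed.

Lemma path_size i j p : is_pathb s t i j p -> (size p < n)%N.
Proof.
by move=> /path_uniq /card_uniqP /= H; rewrite -(size_map t) -H -[X in (_ <= X)%N]card_ord max_card.
Qed.

Local Notation PathT := (PathT n Ar).
Lemma pseq_inj : injective (@pseq n Ar).
Proof.
move=> [l x] [l' x']; rewrite /pseq /= => e.
have ll : l = l' by apply: val_inj; rewrite /= -(size_tuple x) -(size_tuple x') e.
by case: l' / ll x' e => x' /val_inj ->.
Qed.
Lemma pseq_ex (p : seq Ar) : (size p <= n)%N -> exists x : PathT, pseq x = p.
Proof.
rewrite -ltnS => h.
by exists (Tagged (fun l : 'I_n.+1 => l.-tuple Ar) (in_tuple p : (Ordinal h).-tuple Ar)).
Qed.

(** Paths are sorted by their last arrow; the trivial path has none and contributes the term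
    [i == j]. *)
Lemma path_count i j : #|paths_set s t i j| =
  ((i == j) + \sum_(a | t a == j) #|paths_set s t i (s a)|)%N.
Proof.
pose lasto (x : PathT) := ohead (rev (pseq x)).
have last_nil x : (lasto x == None) = (pseq x == [::]).
  by rewrite /lasto; case/lastP: (pseq x) => [//|p b]; rewrite rev_rcons /=; case: p.
have last_rcons x a : lasto x = Some a -> exists p, pseq x = rcons p a.
  by rewrite /lasto; case/lastP: (pseq x) => [//|p b]; rewrite rev_rcons => -[->]; exists p.
have [x0 x0E] := @pseq_ex [::] (leq0n n).
rewrite -sum1_card (partition_big lasto predT) //= (bigD1 None) //=; congr (_ + _)%N.
  rewrite sum1_card; case: (i =P j) => [->|ij].
    rewrite (eq_card (B := pred1 x0)) ?card1 // => y.
    rewrite [LHS]unfold_in /= [RHS]inE last_nil unfold_in /paths_set.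
    apply/andP/eqP => [[_ /eqP H]|->]; last by rewrite x0E /= eqxx.
    by apply: pseq_inj; rewrite x0E.
  apply: eq_card0 => y; rewrite [LHS]unfold_in /= last_nil unfold_in /paths_set.
  by apply/negbTE/negP => /andP [yP /eqP e]; move: yP; rewrite e => /eqP.
rewrite (reindex_omap Some id) /=; last by case.
rewrite [RHS]big_mkcond; apply: eq_big => [a|a _]; first by rewrite eqxx.
rewrite sum1_card; case: (t a =P j) => [taj|taj]; last first.
  apply: eq_card0 => y; rewrite [LHS]unfold_in /= unfold_in /paths_set.
  apply/negbTE/negP => /andP [yP /eqP /last_rcons [p e]].
  by move: yP; rewrite e is_pathb_rcons => /andP [_ /eqP].
(* The default [x0] is never reached on the paths considered: their length is below n, so appending
   an arrow gives length at most n, which is still encoded. *)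
pose h (x : PathT) := odflt x0 [pick y : PathT | pseq y == rcons (pseq x) a].
have hE x : x \in paths_set s t i (s a) -> pseq (h x) = rcons (pseq x) a.
  move=> /path_size sx; rewrite /h; case: pickP => [y /eqP //|H].
  by have [|y /eqP] := @pseq_ex (rcons (pseq x) a); rewrite ?size_rcons ?H.
have h_inj : {in paths_set s t i (s a) &, injective h}.
  move=> x y xP yP e; apply: pseq_inj; have := congr1 (@pseq n Ar) e.
  by rewrite !hE // => /rcons_inj [].
rewrite -(card_in_image h_inj); apply: eq_card => y.
rewrite [LHS]unfold_in /=; apply/andP/imageP => [[yP /eqP /last_rcons [p e]]|[x xP ->]].
  move: (yP); rewrite unfold_in /paths_set e is_pathb_rcons => /andP [pP _].
  have [x xE] := pseq_ex (ltnW (path_size pP)).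
  have xP : x \in paths_set s t i (s a) by rewrite unfold_in /paths_set xE.
  by exists x => //; apply: pseq_inj; rewrite hE // xE e.
by rewrite unfold_in /paths_set /lasto hE // is_pathb_rcons rev_rcons /= taj !eqxx andbT.
Qed.

Lemma proj_euler i W : (\sum_j rdim (proj_rep F s t i) j * rdim W j =
  rdim W i + \sum_a rdim (proj_rep F s t i) (s a) * rdim W (t a))%N.
Proof.
under eq_bigr => j _ do rewrite [rdim _ j]path_count mulnDl.
rewrite big_split /= (bigD1 i) //= eqxx mul1n big1 ?addn0 => [|j /negbTE]; last first.
  by rewrite eq_sym => ->.
congr (_ + _)%N; rewrite [RHS](partition_big t predT) //=; apply: eq_bigr => j _.
by rewrite big_distrl /=; apply: eq_bigr => a /eqP <-.
Qed.

(** All basis paths arise from the trivial one by appending arrows, so its image determines f. *)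
Lemma proj_eval_inj i W (r0 : 'I_#|paths_set s t i i|) :
  pseq (enum_val r0) = [::] -> forall f : C0 (proj_rep F s t i) W,
  f \in Hom (proj_rep F s t i) W -> row r0 (fmx f i) = 0 -> f = 0.
Proof.
move=> r0E f fH f0; apply: famP => j; rewrite fmx0; apply/row_matrixP => r; rewrite row0.
suff H p : forall j (r : 'I_#|paths_set s t i j|), pseq (enum_val r) = p ->
    row r (fmx f j) = 0 by exact: (H _ j r (erefl _)).
elim/last_ind: p => [|p a IH] {}j {}r rE.
  have := enum_valP r; rewrite unfold_in /paths_set rE /= => /eqP ij.
  case: j / ij r rE => r rE; rewrite -[RHS]f0; congr (row _ _).
  by apply: enum_val_inj; apply: pseq_inj; rewrite rE r0E.
have := enum_valP r; rewrite unfold_in /paths_set rE is_pathb_rcons => /andP [pP /eqP taj].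
case: j / taj r rE => r rE.
have [x xE] := pseq_ex (ltnW (path_size pP)).
have xP : x \in paths_set s t i (s a) by rewrite unfold_in /paths_set xE.
have qE : pseq (enum_val (enum_rank_in xP x)) = p by rewrite enum_rankK_in.
have := congr1 (row (enum_rank_in xP x)) (fmx_hom fH a).
rewrite !row_mul (IH _ _ qE) mul0mx => <-.
rewrite [LHS]rowE; congr (_ *m _); apply/rowP => c; rewrite !mxE qE -rE eqxx /=.
by rewrite (inj_eq pseq_inj) (inj_eq enum_val_inj).
Qed.

(** No homomorphism is constructed. Evaluation at the trivial path is injective, so dim Hom(P(i), W)
    <= dim W_i; the Euler form of P(i) gives the opposite inequality. Equality makes Ext^1 vanish
    and the evaluation onto. *)
Lemma proj_Ext0_eval i W : Ext0 (proj_rep F s t i) W /\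
  forall w : 'rV[F]_(rdim W i), exists2 f, f \in Hom (proj_rep F s t i) W
     & exists v, v *m fmx f i = w.
Proof.
set P := proj_rep F s t i.
have [x0 x0E] := @pseq_ex [::] (leq0n n).
have x0P : x0 \in paths_set s t i i by rewrite unfold_in /paths_set x0E /= eqxx.
pose r0 := enum_rank_in x0P x0.
have r0E : pseq (enum_val r0) = [::] by rewrite enum_rankK_in.
pose ev (f : C0 P W) : 'rV[F]_(rdim W i) := row r0 (fmx f i).
have evL : linear ev by move=> k x y; rewrite /ev !fmxE linearP.
pose evl := linfun (HB.pack_for {linear C0 P W -> 'rV[F]_(rdim W i)} ev
   (GRing.isLinear.Build _ _ _ _ ev evL)).
have inj : (Hom P W :&: lker evl = 0)%VS.
  apply/eqP; rewrite -subv0; apply/subvP => f; rewrite memv_cap memv0 => /andP [fH].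
  by rewrite memv_ker lfunE => /eqP f0; apply/eqP; exact: (proj_eval_inj r0E fH f0).
have hd : \dim (evl @: Hom P W) = hdim P W by rewrite limg_dim_eq.
have le : (hdim P W <= rdim W i)%N.
  by rewrite -hd (leq_trans (dimvS (subvf _))) // dimvf /dim /= mul1n.
have ge : (rdim W i <= hdim P W)%N.
  by have := euler_le P W; rewrite proj_euler leq_add2r.
have e : hdim P W = rdim W i by apply/eqP; rewrite eqn_leq le.
split; first by apply/euler_Ext0; rewrite proj_euler e.
move=> w; have : w \in (evl @: Hom P W)%VS.
  suff -> : (evl @: Hom P W)%VS = fullv by rewrite memvf.
  by apply/eqP; rewrite eqEdim subvf hd e dimvf /dim /= mul1n.
move=> /memv_imgP [f fH ->]; exists f => //; exists (delta_mx 0 r0).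
by rewrite lfunE /= /ev -rowE.
Qed.

End Projectives.

(** * Approximations, universal extensions, and tilting as maximal rigidity *)

Section Approximations.
Set Implicit Arguments. Unset Strict Implicit. Unset Printing Implicit Defensive.
Import GRing.Theory.
Local Open Scope ring_scope.
Local Open Scope fam_scope.
Variables (F : fieldType) (n : nat) (Ar : finType) (s t : Ar -> 'I_n).
Local Notation rep := (rep F s t).
Local Notation C0 V W := (fam F (rdim V) (rdim W)).
Local Notation C1 V W := (fam F (fun a => rdim V (s a)) (fun a => rdim W (t a))).
Local Notation "\1_ V" := (fone F (rdim V)) (at level 8, V at level 2).
Implicit Types U V W X Y Z M P E K : rep.

Lemma copies_biproduct m M : exists i p,
  @biproduct F n Ar s t 'I_m (enum 'I_m) (fun _ => M) (copies m M) i p.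
Proof.
have [i [p B]] := dsum_list_biproduct (fun _ : 'I_m => M) (enum_uniq 'I_m).
rewrite /copies; have -> : nseq m M = [seq M | j <- enum 'I_m]; last by exists i, p.
by elim: m {i p B} => [|m IH] /=; rewrite ?enum_ord0 // enum_ordSl /= IH -map_comp.
Qed.

Lemma hom_basis V W : exists m (b : 'I_m -> C0 V W),
  (forall l, b l \in Hom V W) /\
  forall h, h \in Hom V W -> exists a : 'I_m -> F, h = \sum_l a l *: b l.
Proof.
exists (\dim (Hom V W)), (fun l => (vbasis (Hom V W))`_l); split=> [l|h hH].
  by apply: vbasis_mem; rewrite mem_nth ?size_tuple.
by exists (fun l => coord (vbasis (Hom V W)) l h); exact: coord_vbasis.
Qed.

(** The components of g run through a basis of Hom(M, V), so every map M -> V factors through g;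
    maps from add M are reduced to this case. *)
Lemma right_approx M V : exists m (g : C0 (copies m M) V), g \in Hom (copies m M) V /\
  forall N h, adds M N -> h \in Hom N V ->
    exists2 h', h' \in Hom N (copies m M) & h' ** g = h.
Proof.
have [m [b [bH bE]]] := hom_basis M V; exists m.
have [i [p [iH pH _ diag off one]]] := copies_biproduct m M.
exists (\sum_l p l ** b l); split; first by apply: hom_sum => l _; homt.
move=> N h [q [u [v [uH vH e]]]] hH.
have key k : exists h', h' \in Hom M (copies m M) /\ h' ** (\sum_l p l ** b l) = v k ** h.
  have [a ->] := bE _ (homM (vH k) hH).
  exists (\sum_l a l *: i l); split; first by apply: hom_sum => l _; homt.
  rewrite fmul_suml; apply: eq_bigr => l _.
  rewrite fmul_sumr (bigD1 l) //= big1 => [|k' kl].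
    by rewrite fmulA fmulZl diag ?mem_enum // fmulZl fmul1 addr0.
  by rewrite fmulA fmulZl off ?scaler0 ?fmul0 // eq_sym.
have [h' h'E] := fin_all_exists key.
exists (\sum_k u k ** h' k).
  by apply: hom_sum => k _; apply: homM => //; case: (h'E k).
rewrite -[RHS]fmul1 e !fmul_suml; apply: eq_bigr => k _.
by rewrite -!fmulA; case: (h'E k) => _ ->.
Qed.

Lemma left_approx M V : exists m (g : C0 V (copies m M)), g \in Hom V (copies m M) /\
  forall N h, adds M N -> h \in Hom V N ->
    exists2 h', h' \in Hom (copies m M) N & g ** h' = h.
Proof.
have [m [b [bH bE]]] := hom_basis V M; exists m.
have [i [p [iH pH _ diag off one]]] := copies_biproduct m M.
exists (\sum_l b l ** i l); split; first by apply: hom_sum => l _; homt.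
move=> N h [q [u [v [uH vH e]]]] hH.
have key k : exists h', h' \in Hom (copies m M) M /\ (\sum_l b l ** i l) ** h' = h ** u k.
  have [a ->] := bE _ (homM hH (uH k)).
  exists (\sum_l a l *: p l); split; first by apply: hom_sum => l _; homt.
  rewrite fmul_sumr; apply: eq_bigr => l _.
  rewrite fmul_suml (bigD1 l) //= big1 => [|k' kl].
    by rewrite -fmulA fmulZr diag ?mem_enum // fmulZr fmulr1 addr0.
  by rewrite -fmulA fmulZr off ?scaler0 ?fmulr0.
have [h' h'E] := fin_all_exists key.
exists (\sum_k h' k ** v k).
  by apply: hom_sum => k _; apply: homM => //; case: (h'E k).
rewrite -[RHS]fmulr1 e !fmul_sumr; apply: eq_bigr => k _.
by rewrite !fmulA; case: (h'E k) => _ ->.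
Qed.

Lemma ext_exists X Y (c : C1 Y X) : exists E (f : C0 X E) (g : C0 E Y) (f' : C0 E X) (g' : C0 Y E),
  [/\ f \in Hom X E /\ g \in Hom E Y, f ** f' = \1_X /\ g' ** g = \1_Y, f ** g = 0,
      f' ** f + g ** g' = \1_E & diff g' = ract c f].
Proof.
(* The sign of the corner block is the one for which the differential of the section [inr X Y] is c
   followed by f. *)
pose E : rep := @Rep F n Ar s t (fun j => (rdim X j + rdim Y j)%N)
   (fun a => block_mx (rmap X a) 0 (- fmx c a) (rmap Y a)).
exists E, (inl X Y), (prr X Y), (prl X Y), (inr X Y); split.
- split; apply/homP/famP => a; rewrite !fmxE /=.
    rewrite mul_row_block mul_mx_row.
    by rewrite !(mul0mx, mulmx0, mul1mx, mulmx1) !addr0 subrr.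
  rewrite mul_block_col mul_col_mx.
  by rewrite !(mul0mx, mulmx0, mul1mx, mulmx1) !add0r subrr.
- by rewrite inl_prl inr_prr.
- exact: inl_prr.
- exact: dsum1.
apply: famP => a; rewrite !fmxE /= mul_row_block !mul_mx_row opp_row_mx add_row_mx.
by rewrite !(mul0mx, mulmx0, mul1mx, mulmx1) !add0r subrr opprK.
Qed.

Lemma exact_intro X E Y (f : C0 X E) (g : C0 E Y) (f' : C0 E X) (g' : C0 Y E) :
  f \in Hom X E -> g \in Hom E Y -> f ** f' = \1_X -> g' ** g = \1_Y -> f ** g = 0 ->
  f' ** f + g ** g' = \1_E -> exact f g.
Proof. by move=> ? ? ? ? ? ?; split=> //; exists f', g'. Qed.

Lemma exact_ses X E Y (f : C0 X E) (g : C0 E Y) :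
  exact f g -> ses (fmx f : hom X E) (fmx g : hom E Y).
Proof.
move=> [fH gH [f' [g' [ff gg fg e]]]]; split; try exact: fmx_hom.
move=> j; move: (congr1 (fun z => fmx z j) ff) (congr1 (fun z => fmx z j) gg).
move: (congr1 (fun z => fmx z j) fg) (congr1 (fun z => fmx z j) e).
rewrite !fmxE => {}e {}fg {}ff {}gg; split.
- by apply/row_freeP; exists (fmx f' j).
- by apply/row_fullP; exists (fmx g' j).
apply/andP; split; first by apply/sub_kermxP.
rewrite -[kermx _]mulmx1 -fg mulmxDr !mulmxA mulmx_ker mul0mx addr0.
exact: submxMl.
Qed.

Lemma ses_exact X E Y (f : hom X E) (g : hom E Y) :
  ses f g -> exact (mkfam f : C0 X E) (mkfam g : C0 E Y).
Proof.
move=> [/homE fH /homE gH H].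
have fgE j : f j *m g j = 0.
  by have [_ _ /andP [+ _]] := H j; move/sub_kermxP.
pose z j : 'M[F]_(rdim E j, rdim X j) :=
  (1%:M - g j *m pinvmx (g j)) *m pinvmx (f j).
have zE j : z j *m f j = 1%:M - g j *m pinvmx (g j).
  have [_ gf /andP [_ le]] := H j; rewrite mulmxKpV //.
  apply: submx_trans le; apply/sub_kermxP.
  by rewrite mulmxBl mul1mx mulmxKpV // subrr.
apply: (@exact_intro _ _ _ _ _ (mkfam z) (mkfam (fun j => pinvmx (g j)))) => //;
  apply: famP => j; rewrite !fmxE //; have [ff gf _] := H j.
- by apply: (row_free_inj ff); rewrite -mulmxA zE mulmxBr mulmx1 mulmxA fgE mul0mx subr0 mul1mx.
- exact: mulVpmx.
by rewrite zE subrK.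
Qed.

Lemma exact_split X E Y (f : C0 X E) (g : C0 E Y) : exact f g -> Ext0 Y X ->
  (exists2 r, r \in Hom E X & f ** r = \1_X) /\ (exists2 q, q \in Hom Y E & q ** g = \1_Y).
Proof.
move=> fg YX; split; first exact: exact_extend fg YX (hom1 X).
exact: exact_colift fg YX (hom1 Y).
Qed.

Lemma ext1_zeroE Y X : ext1_zero Y X <-> Ext0 Y X.
Proof.
split=> [H c|YX E f g /ses_exact /exact_split /(_ YX) [[r rH fr] _]].
  have [E [f [g [f' [g' [[fH gH] [ff gg] fg e dg]]]]]] := ext_exists c.
  have [r [/homE rH fr]] := H E _ _ (exact_ses (exact_intro fH gH ff gg fg e)).
  exists (g' ** mkfam r); rewrite diffMl // dg ractA -[RHS]ract1; congr ract.
  by apply: famP => j; rewrite fmxE fmxE fr fmxE.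
exists (fmx r); split; first exact: fmx_hom.
by move=> i; have := congr1 (fun z => fmx z i) fr; rewrite !fmxE.
Qed.

Lemma C1_basis V W : exists m (b : 'I_m -> C1 V W),
  forall h, exists a : 'I_m -> F, h = \sum_l a l *: b l.
Proof.
exists (\dim {:C1 V W}), (fun l => (vbasis {:C1 V W})`_l) => h.
by exists (fun l => coord (vbasis {:C1 V W}) l h); apply: coord_vbasis; rewrite memvf.
Qed.

(* Bongartz' universal extension: the cocycle runs through a basis of C1 M P, so that
   Hom(M, M^m) -> Ext^1(M, P) is onto. *)
Lemma bongartz P M : (forall W, Ext0 P W) -> Ext0 M M ->
  exists m E (f : C0 P E) (g : C0 E (copies m M)),
  [/\ exact f g, Ext0 M E, Ext0 E M & Ext0 E E].
Proof.
move=> PW MM; have [m [b bE]] := C1_basis M P; exists m.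
have [i [p [iH pH _ diag off one]]] := copies_biproduct m M.
pose c : C1 (copies m M) P := \sum_l lact (p l) (b l).
have ic l : lact (i l) c = b l.
  rewrite /c lact_sumr (bigD1 l) //= big1 => [|k kl].
    by rewrite lactA diag ?mem_enum // lact1 addr0.
  by rewrite lactA off ?lact0l // eq_sym.
have [E [f [g [f' [g' [[fH gH] [ff gg] fg e dg]]]]]] := ext_exists c.
have MC := adds_copies M m.
have ex := exact_intro fH gH ff gg fg e.
have ME : Ext0 M E.
  move=> d; have [x dx] := Ext0_adds_r MC MM (ract d g).
  pose d' := d - diff (x ** g').
  have d'g : ract d' g = 0.
    by rewrite ractDl ractNl -diffMl // -fmulA gg fmulr1 dx subrr.
  have d'E : ract (ract d' f') f = d'.
    by rewrite -[RHS]ract1 -e ractDr -(ractA _ g) d'g ract0l addr0 ractA.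
  have [a aE] := bE (ract d' f').
  pose h : C0 M (copies m M) := \sum_l a l *: i l.
  have hH : h \in Hom M (copies m M) by apply: hom_sum => l _; homt.
  have hc : lact h c = ract d' f'.
    rewrite aE /h lact_suml.
    by apply: eq_bigr => l _; rewrite lactZl ic.
  exists (x ** g' + h ** g').
  by rewrite linearD /= (diffMr g' hH) dg lract hc d'E addrC subrK.
have EM : Ext0 E M by apply: exact_Ext0_midl ex (PW _) (Ext0_adds_l MC MM).
exists E, f, g; split=> //.
exact: exact_Ext0_midl ex (PW _) (Ext0_adds_l MC ME).
Qed.

(** For acyclic quivers this is equivalent to [tilting], by [tilting_maximal] and [maximal_tilting],
    and it is the form in which tilting is used. *)
Definition maximal_rigid M : Prop := Ext0 M M /\
  forall Z, Ext0 M Z -> Ext0 Z M -> Ext0 Z Z -> adds M Z.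

Hypothesis hQ : acyclic s t.
Local Notation R := (regular_rep F s t).

Lemma regular_adds i : adds R (proj_rep F s t i).
Proof.
have [j [p B]] := dsum_list_biproduct (proj_rep F s t) (enum_uniq 'I_n).
by apply: adds_biproduct B _; rewrite mem_enum.
Qed.

Lemma regular_Ext0 W : Ext0 R W.
Proof.
rewrite /regular_rep; elim: (enum 'I_n) => [|i r IH] /=.
  move=> c; exists 0; rewrite -[c]lact1 -[lact _ _]/(lact \1_(zero_rep F s t) c).
  by rewrite (iffLR (is_zeroE (zero_rep F s t))) // lact0l linear0.
by apply: Ext0_dsuml => //; have [] := proj_Ext0_eval hQ i W.
Qed.

(** Every vector at a vertex j is a value of a map from P(j), and that map factors through the
    approximation. *)
Lemma regular_cover V : exists m (g : C0 (copies m R) V), epi g.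
Proof.
have [m [g [gH gE]]] := right_approx R V; exists m, g; split=> //.
suff full j : row_full (fmx g j).
  exists (mkfam (fun j => pinvmx (fmx g j))).
  by apply: famP => j; rewrite !fmxE mulVpmx.
rewrite -sub1mx; apply/row_subP => r.
have [_ /(_ (row r 1%:M)) [f fH [v <-]]] := proj_Ext0_eval hQ j V.
have [h hH <-] := gE _ f (regular_adds j) fH.
by rewrite fmxE mulmxA submxMl.
Qed.

Lemma proj_adds K : (forall W, Ext0 K W) -> adds R K.
Proof.
move=> KW; have [m [g eg]] := regular_cover K.
have [X [f ex]] := epi_exact eg.
have [_ [q qH qg]] := exact_split ex (KW _).
by apply: adds_split qH _ qg (adds_copies R m); case: eg.
Qed.

(** The kernel of a projective cover by copies of the regular module has vanishing Ext^1 into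
    everything, since Ext^1 is right exact; so it is projective. *)
Lemma pd_le1_all V : pd_le1 V.
Proof.
have [m [g eg]] := regular_cover V.
have [K [f ex]] := epi_exact eg.
have RmW W : Ext0 (copies m R) W := Ext0_adds_l (adds_copies R m) (@regular_Ext0 W).
exists K, (copies m R), (fmx f), (fmx g); split; last exact: exact_ses.
  by apply/in_addE/proj_adds => W; apply: Ext0_mono (exact_mono ex) _.
by apply/in_addE; apply: adds_copies.
Qed.

(** If Ext^1(M, W) = 0, maps from the regular module to W extend to T1 and then factor through the
    add M-approximation of W; as W is covered by regular modules, the approximation is epi. This is
    used for Z and then for the kernel K of its approximation. *)
Lemma tilting_maximal M : tilting M -> maximal_rigid M.
Proof.
move=> [_ /ext1_zeroE MM [T1 [T2 [f0 [g0 [/in_addE MT1 /in_addE MT2 /ses_exact ex0]]]]]].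
split=> // Z MZ ZM _.
have gen W : Ext0 M W -> exists m (g : C0 (copies m M) W), epi g /\
    forall N h, adds M N -> h \in Hom N W -> exists2 h', h' \in Hom N (copies m M) & h' ** g = h.
  move=> MW; have [m [g [gH gE]]] := right_approx M W; exists m, g; split=> //; split=> //.
  have [k [q [qH [u uq]]]] := regular_cover W.
  have RE h : h \in Hom R W -> exists h', h' \in Hom R (copies m M) /\ h' ** g = h.
    move=> hH; have [h1 h1H <-] := exact_extend ex0 (Ext0_adds_l MT2 MW) hH.
    have [h2 h2H <-] := gE _ _ MT1 h1H.
    by exists (mkfam f0 ** h2); rewrite fmulA homM //; case: ex0.
  have [l [x [y [xH yH e]]]] := adds_copies R k.
  have [w wE] := fin_all_exists (fun i => RE _ (homM (yH i) qH)).
  exists (u ** \sum_i x i ** w i); rewrite -uq -[q in RHS]fmul1 e -fmulA !fmul_suml.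
  by congr (_ ** _); apply: eq_bigr => i _; rewrite -!fmulA; case: (wE i) => _ ->.
have [m [g [eg gE]]] := gen Z MZ.
have [K [f ex]] := epi_exact eg.
(* The approximation property makes Hom(M, M^m) -> Hom(M, Z) onto, so Ext^1(M, K) = 0. Hence K is
   generated by M, Ext^1(Z, K) = 0, and Z splits off M^m. *)
have MK : Ext0 M K.
  apply: exact_Ext0_ker ex (Ext0_adds_r (adds_copies M m) MM) _ => h hH.
  by apply: gE => //; apply: adds_refl.
have [m' [g' [eg' _]]] := gen K MK.
have ZK : Ext0 Z K := Ext0_epi eg' (Ext0_adds_r (adds_copies M m') ZM).
have [_ [q qH qg]] := exact_split ex ZK.
by apply: adds_split qH _ qg (adds_copies M m); case: eg.
Qed.

Lemma maximal_bongartz P M : (forall W, Ext0 P W) -> maximal_rigid M ->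
  exists m E (f : C0 P E) (g : C0 E (copies m M)), exact f g /\ adds M E.
Proof.
move=> PW [MM max]; have [m [E [f [g [ex ME EM EE]]]]] := bongartz PW MM.
by exists m, E, f, g; split=> //; apply: max.
Qed.

(** Bongartz' sequence for the regular module is the required coresolution. *)
Lemma maximal_tilting M : maximal_rigid M -> tilting M.
Proof.
move=> maxM; have [MM _] := maxM; split; [exact: pd_le1_all | exact/ext1_zeroE |].
have [m [E [f [g [ex ME]]]]] := maximal_bongartz (@regular_Ext0) maxM.
exists E, (copies m M), (fmx f), (fmx g); split; [exact/in_addE | | exact: exact_ses].
by apply/in_addE; apply: adds_copies.
Qed.

End Approximations.

(** * Krull-Schmidt and the number of summands *)

Section Counting.
Set Implicit Arguments. Unset Strict Implicit. Unset Printing Implicit Defensive.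
Import GRing.Theory.
Local Open Scope ring_scope.
Local Open Scope fam_scope.
Variables (F : closedFieldType) (n : nat) (Ar : finType) (s t : Ar -> 'I_n).
Local Notation rep := (rep F s t).
Local Notation C0 V W := (fam F (rdim V) (rdim W)).
Local Notation "\1_ V" := (fone F (rdim V)) (at level 8, V at level 2).
Implicit Types U V W X Y Z M P E K : rep.

Lemma exact_dim X E Y (f : C0 X E) (g : C0 E Y) j :
  exact f g -> rdim E j = (rdim X j + rdim Y j)%N.
Proof.
move=> [fH gH [f' [g' [ff gg fg e]]]].
have gf : g' ** f' = 0.
  have : g' ** (f' ** f + g ** g') ** f' = g' ** f' by rewrite e fmulr1.
  rewrite fmulDr !fmulA gg fmul1 fmulDl -!fmulA ff fmulr1.
  by rewrite -[RHS]add0r => /addIr.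
pose x : C0 E (dsum X Y) := f' ** inl X Y + g ** inr X Y.
pose y : C0 (dsum X Y) E := prl X Y ** f + prr X Y ** g'.
have xy : x ** y = \1_E.
  rewrite fmulDl !fmulDr !fmul_mid inl_prl inl_prr inr_prl inr_prr.
  by rewrite !(fmulr1, fmulr0, fmul0) add0r addr0.
have yx : y ** x = \1_(dsum X Y).
  rewrite fmulDl !fmulDr !fmul_mid ff fg gf gg.
  by rewrite !(fmulr1, fmulr0, fmul0) add0r addr0 dsum1.
by apply/eqP; rewrite eqn_leq (fmono_le xy) (fmono_le yx).
Qed.

(** The identity of Z is a sum of endomorphisms through the X_j, each a scalar. One scalar is
    nonzero, and it makes Z a summand of that X_j. *)
Lemma krull_schmidt (J : eqType) (r : seq J) (X : J -> rep) M i p Z :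
  @biproduct _ _ _ s t J r X M i p -> (forall j, j \in r -> indecomposable (X j)) ->
  indecomposable Z -> Ext0 Z Z -> adds M Z -> exists2 j, j \in r & iso Z (X j).
Proof.
move=> [iH pH _ _ _ one] indX indZ ZZ [m [u [v [uH vH e]]]].
apply: NNPP => H; apply: (indec_neq0 indZ); rewrite e big1 // => k _.
rewrite -[u k]fmulr1 -one fmul_sumr fmul_suml big1_seq // => j /andP [_ jr].
rewrite fmulA -(fmulA _ (i j)).
have xH : u k ** p j \in Hom Z (X j) by homt.
have yH : i j ** v k \in Hom (X j) Z by homt.
have [l lE] := End_scalar indZ ZZ (homM xH yH).
have [l0|l0] := eqVneq l 0; first by rewrite lE l0 scale0r.
case: H; exists j => //.
apply: (indec_summand (indX j jr) (homZ l^-1 xH) yH _ (indec_neq0 indZ)).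
by rewrite fmulZl lE scalerA mulVf // scale1r.
Qed.

Lemma indec_ind (Q : rep -> Prop) : (forall Z, \1_Z = 0 -> Q Z) ->
  (forall Z, indecomposable Z -> Q Z) ->
  (forall Z Z1 Z2, iso Z (dsum Z1 Z2) -> Q Z1 -> Q Z2 -> Q Z) -> forall Z, Q Z.
Proof.
move=> Q0 Qi Qs Z; have [N] := ubnP (tdim Z); elim: N Z => // N IH Z le.
case: (classic (\1_Z = 0)) => [/Q0 //|Z0].
case: (classic (indecomposable Z)) => [/Qi //|H].
have [Z1 [Z2 [ZZ [nz1 nz2]]]] : exists Z1 Z2, iso Z (dsum Z1 Z2) /\ ~ is_zero Z1 /\ ~ is_zero Z2.
  apply: NNPP => H2; apply: H; split=> [/is_zeroE //|Z1 Z2 ZZ].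
  apply: NNPP => H3; apply: H2; exists Z1, Z2; split=> //.
  by split=> H4; apply: H3; [left | right].
have dZ := tdim_iso ZZ; rewrite tdim_dsum in dZ.
have t1 : (0 < tdim Z1)%N by apply: tdim_gt0 => /is_zeroE.
have t2 : (0 < tdim Z2)%N by apply: tdim_gt0 => /is_zeroE.
have lt1 : (tdim Z1 < tdim Z)%N by rewrite dZ -[X in (X < _)%N]addn0 ltn_add2l.
have lt2 : (tdim Z2 < tdim Z)%N by rewrite dZ -[X in (X < _)%N]add0n ltn_add2r.
by apply: (Qs _ _ _ ZZ); apply: IH; [exact: leq_trans lt1 le | exact: leq_trans lt2 le].
Qed.

Section Family.
Variables (J : finType) (X : J -> rep) (T : rep).
Hypotheses (indX : forall j, indecomposable (X j)) (isoX : forall i j, i != j -> ~ iso (X i) (X j)).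
Variables (i : forall j, C0 (X j) T) (p : forall j, C0 T (X j)).
Hypothesis (TX : @biproduct _ _ _ s t J (enum J) X T i p).
Hypothesis (TT : Ext0 T T).

Lemma family_adds j : adds T (X j).
Proof. by apply: adds_biproduct TX _; rewrite mem_enum. Qed.

Lemma family_adds_dim Z : adds T Z -> exists m : J -> nat, forall v, rdim Z v = (\sum_j m j * rdim (X j) v)%N.
Proof.
elim/indec_ind: Z => [Z /is_zeroE Z0 _|Z indZ TZ|Z Z1 Z2 ZZ IH1 IH2 TZ].
- by exists (fun=> 0%N) => v; rewrite Z0 big1.
- have [j _ Zj] := krull_schmidt TX (fun j _ => indX j) indZ (Ext0_adds TZ TZ TT) TZ.
  exists (fun k => (k == j) : nat) => v; rewrite (iso_dim Zj) (bigD1 j) //= eqxx mul1n.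
  by rewrite big1 ?addn0 // => k /negbTE ->.
have TZZ := adds_iso ZZ TZ.
have [m1 m1E] := IH1 (adds_trans TZZ (adds_dsuml Z1 Z2)).
have [m2 m2E] := IH2 (adds_trans TZZ (adds_dsumr Z1 Z2)).
exists (fun j => m1 j + m2 j)%N => v; rewrite (iso_dim ZZ) /= m1E m2E -big_split.
by apply: eq_bigr => j _; rewrite mulnDl.
Qed.

Lemma family_rig j k : Ext0 (X j) (X k).
Proof. exact: Ext0_adds (family_adds j) (family_adds k) TT. Qed.

Lemma family_le : (#|J| <= n)%N.
Proof. exact: card_le_n indX isoX (@family_rig). Qed.

(** An indecomposable Z compatible with T but isomorphic to no X_j would enlarge the family to n + 1
    members; a decomposable Z is treated by induction on its summands. *)
Lemma family_maximal : #|J| = n -> maximal_rigid T.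
Proof.
move=> Jn; split=> // Z; elim/indec_ind: Z => [Z /adds_zero //|Z indZ TZ ZT ZZ|Z Z1 Z2 ZZ IH1 IH2 TZ ZT Z2E].
  case: (classic (exists j, iso Z (X j))) => [[j /iso_sym Zj]|H].
    exact: adds_iso Zj (family_adds j).
  pose X' (o : option J) := if o is Some j then X j else Z.
  suff : (#|{: option J}| <= n)%N by rewrite card_option Jn ltnn.
  apply: (@card_le_n F n Ar s t _ X').
  - by case.
  - move=> [j|] [k|] //= jk; first exact: isoX.
      by move=> /iso_sym H2; apply: H; exists j.
    by move=> H2; apply: H; exists k.
  move=> [j|] [k|] //=; first exact: family_rig.
    exact: Ext0_adds_l (family_adds j) TZ.
  exact: Ext0_adds_r (family_adds k) ZT.
have Z1a : adds Z Z1 by apply: adds_trans (adds_iso ZZ (adds_refl Z)) (adds_dsuml _ _).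
have Z2a : adds Z Z2 by apply: adds_trans (adds_iso ZZ (adds_refl Z)) (adds_dsumr _ _).
apply: adds_iso (iso_sym ZZ) (adds_dsum (IH1 _ _ _) (IH2 _ _ _)).
- exact: Ext0_adds_r Z1a TZ.
- exact: Ext0_adds_l Z1a ZT.
- exact: (Ext0_adds Z1a Z1a Z2E).
- exact: Ext0_adds_r Z2a TZ.
- exact: Ext0_adds_l Z2a ZT.
- exact: (Ext0_adds Z2a Z2a Z2E).
Qed.

Hypothesis hQ : acyclic s t.

(* The dimension vectors of the projectives form the inverse of the matrix of the Euler form, and
   their Bongartz extensions lie in add T. *)
Lemma family_span : maximal_rigid T -> forall v : 'I_n, exists a : J -> int,
  forall w, (v == w)%:R = \sum_j a j * (rdim (X j) w)%:R.
Proof.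
move=> maxT v.
pose P : 'M[int]_n := \matrix_(i, j) #|paths_set s t i j|%:R.
pose N : 'M[int]_n := \matrix_(i, j) (\sum_(a | (s a == i) && (t a == j)) 1)%N%:R.
have PN : P *m (1%:M - N) = 1%:M.
  apply/eqP; rewrite mulmxBr mulmx1 subr_eq; apply/eqP/matrixP => k l.
  rewrite !mxE path_count // natrD; congr (_ + _).
  rewrite (partition_big s predT) //= natr_sum; apply: eq_bigr => q _.
  rewrite !mxE !natr_sum mulr_sumr; under eq_bigl do rewrite andbC.
  by apply: eq_bigr => a /andP [/eqP -> _]; rewrite mulr1.
have /matrixP NP := mulmx1C PN.
have proj k : exists a : J -> int, forall w, P k w = \sum_j a j * (rdim (X j) w)%:R.
  have PW W : Ext0 (proj_rep F s t k) W by have [] := proj_Ext0_eval hQ k W.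
  have [m [E [f [g [ex /family_adds_dim [mE mEE]]]]]] := maximal_bongartz PW maxT.
  have [mC mCE] := family_adds_dim (adds_copies T m).
  exists (fun j => (mE j)%:R - (mC j)%:R) => w; rewrite mxE.
  have /eqP := congr1 (fun m => m%:R : int) (exact_dim w ex).
  rewrite mEE mCE natrD -subr_eq => /eqP <-; rewrite !natr_sum -sumrB.
  by apply: eq_bigr => j _; rewrite mulrBl !natrM.
have [a aE] := fin_all_exists proj.
exists (fun j => \sum_k (1%:M - N) v k * a k j) => w.
have := NP v w; rewrite [RHS]mxE => <-; rewrite mxE.
under eq_bigr => k _ do rewrite aE mulr_sumr.
rewrite exchange_big; apply: eq_bigr => j _; rewrite mulr_suml.
by apply: eq_bigr => k _; rewrite mulrA.
Qed.

Lemma family_card : maximal_rigid T -> #|J| = n.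
Proof.
move=> maxT; apply/eqP; rewrite eqn_leq family_le /=.
have [a aE] := fin_all_exists (family_span maxT).
pose A : 'M[rat]_(n, #|J|) := \matrix_(v, k) (a v (enum_val k))%:~R.
pose B : 'M[rat]_(#|J|, n) := \matrix_(k, w) (rdim (X (enum_val k)) w)%:R.
have AB : A *m B = 1%:M.
  apply/matrixP => v w; rewrite !mxE -[RHS](rmorph_nat (intr : int -> rat)) aE rmorph_sum /=.
  rewrite (reindex (fun k : 'I_#|J| => enum_val k)) /=; last by apply: onW_bij; apply: enum_val_bij.
  by apply: eq_bigr => k _; rewrite !mxE rmorphM /= rmorph_nat.
by rewrite -(mxrank1 rat n) -AB (leq_trans (mxrankM_maxl _ _)) // rank_leq_col.
Qed.

End Family.
End Counting.

(** * Exchange sequences, and generated and cogenerated complements *)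

Section Exchange.
Set Implicit Arguments. Unset Strict Implicit. Unset Printing Implicit Defensive.
Import GRing.Theory.
Local Open Scope ring_scope.
Local Open Scope fam_scope.
Variables (F : closedFieldType) (n : nat) (Ar : finType) (s t : Ar -> 'I_n).
Local Notation rep := (rep F s t).
Local Notation C0 V W := (fam F (rdim V) (rdim W)).
Local Notation "\1_ V" := (fone F (rdim V)) (at level 8, V at level 2).
Implicit Types U V W X Y Z M N P E K : rep.

Definition cogen M X : Prop := exists N (f : C0 X N), adds M N /\ mono f.
Definition gen M X : Prop := exists N (g : C0 N X), adds M N /\ epi g.
Definition exchange M X Y : Prop :=
  exists N (f : C0 X N) (g : C0 N Y), adds M N /\ exact f g.

Lemma exchange_cogen M X Y : exchange M X Y -> cogen M X.
Proof. by move=> [N [f [g [MN /exact_mono mf]]]]; exists N, f. Qed.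
Lemma exchange_gen M X Y : exchange M X Y -> gen M Y.
Proof. by move=> [N [f [g [MN /exact_epi mf]]]]; exists N, g. Qed.

Lemma ex_min_nat (Q : nat -> Prop) : (exists k, Q k) -> exists2 k, Q k & forall l, Q l -> (k <= l)%N.
Proof.
move=> [k]; elim/ltn_ind: k => k IH Qk.
case: (classic (exists2 l, (l < k)%N & Q l)) => [[l lk Ql]|H]; first exact: IH Ql.
by exists k => // l Ql; rewrite leqNgt; apply/negP => lk; apply: H; exists l.
Qed.

Lemma exchange_nonsplit M X Y : ~ adds M X -> exchange M X Y -> ~ Ext0 Y X.
Proof.
move=> nX [N [f [g [MN ex]]]] YX; apply: nX.
have [[r rH fr] _] := exact_split ex YX.
by apply: adds_split _ rH fr MN; case: ex.
Qed.

Lemma exchange_nonsplit' M X Y : ~ adds M Y -> exchange M X Y -> ~ Ext0 Y X.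
Proof.
move=> nY [N [f [g [MN ex]]]] YX; apply: nY.
have [_ [q qH qg]] := exact_split ex YX.
by apply: adds_split qH _ qg MN; case: ex.
Qed.

(** Y is the cokernel of a left add M-approximation X -> N with N of least total dimension. The
    approximation property gives Ext^1(Y, M) = 0; minimality forbids nonzero summands of Y in add M
    and thereby yields indecomposability. *)
Lemma exchange_exists M X : indecomposable X -> ~ adds M X ->
  Ext0 M M -> Ext0 M X -> Ext0 X M -> Ext0 X X -> cogen M X ->
  exists Y, [/\ indecomposable Y, ~ adds M Y, Ext0 Y M /\ Ext0 M Y, Ext0 Y Y & exchange M X Y].
Proof.
move=> indX nX MM MX XM XX [N0 [j0 [MN0 [j0H [j0' jj]]]]].
pose approx N (f : C0 X N) := [/\ adds M N, f \in Hom X N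
  & forall N' h, adds M N' -> h \in Hom X N' -> exists2 h', h' \in Hom N N' & f ** h' = h].
have [|k [N [f [tN [MN fH fE]]]] min] :=
    @ex_min_nat (fun k => exists N (f : C0 X N), tdim N = k /\ approx N f).
  have [m [g [gH gE]]] := left_approx M X.
  by exists (tdim (copies m M)), (copies m M), g; split=> //; split=> //; apply: adds_copies.
have {k tN}min N' (f' : C0 X N') : approx N' f' -> (tdim N <= tdim N')%N.
  by move=> H; rewrite tN; apply: min; exists N', f'.
have mf : mono f.
  split=> //; have [h' _ h'E] := fE _ _ MN0 j0H.
  by exists (h' ** j0'); rewrite fmulA h'E.
have [Y [g ex]] := mono_exact mf; have [_ gH _] := ex.
have NM : Ext0 N M := Ext0_adds_l MN MM.
have YM : Ext0 Y M.
  by apply: exact_Ext0_coker ex NM _ => h hH; apply: fE => //; apply: adds_refl.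
have MY : Ext0 M Y := Ext0_epi (exact_epi ex) (Ext0_adds_r MN MM).
have YY : Ext0 Y Y := Ext0_epi (exact_epi ex) (Ext0_adds_r MN YM).
have exY : exchange M X Y by exists N, f, g.
have nY : ~ adds M Y.
  by move=> MaY; apply: (exchange_nonsplit nX exY); apply: Ext0_adds_l MaY MX.
have nosum N' (v : C0 N' Y) (r : C0 Y N') : v \in Hom N' Y -> r \in Hom Y N' ->
    v ** r = \1_N' -> adds M N' -> \1_N' = 0.
  move=> vH rH vr MN'.
  have [u uH uE] := exact_colift ex (Ext0_adds_l MN' MX) vH.
  have grH : g ** r \in Hom N N' by homt.
  have ugr : u ** (g ** r) = \1_N' by rewrite fmulA uE.
  have [Z [i [q [iH qH iq uq [igr e]]]]] := split_compl uH grH ugr.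
  have := tdim_iso (split_iso uH grH iH qH ugr iq uq igr e); rewrite tdim_dsum => tNZ.
  (* A summand N' of Y in add M lifts to a summand of N on which f has no component, so f remains an
     approximation into the complement Z. Minimality leaves N' = 0. *)
  apply: tdim0; apply/eqP; rewrite -leqn0 -(leq_add2r (tdim Z)) add0n -tNZ.
  have [fg fqi] : f ** g = 0 /\ f ** q ** i = f.
    have fg : f ** g = 0 by case: ex => _ _ [? [? []]].
    by split=> //; rewrite -[RHS]fmulr1 -e fmulDr !fmulA fg !fmul0 add0r.
  apply: (min Z (f ** q)); split; [exact: adds_split iH qH iq MN | homt |].
  move=> N1 h MN1 hH; have [h' h'H h'E] := fE _ _ MN1 hH.
  by exists (i ** h'); [homt | rewrite fmulA fqi].
exists Y; split=> //; apply: indec_intro => [/(@adds_zero _ _ _ _ _ M) //|].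
move=> Z1 Z2 i1 p1 i2 p2 i1H p1H i2H p2H ip1 ip2 i2p1.
(* The idempotent e = p1 i1 of Y lifts to an endomorphism a of N, which induces a scalar c on X.
   Then a - c vanishes on X, so e - c factors through N. If c = 0 this puts Z1 into add M, otherwise
   Z2. *)
have eH : g ** (p1 ** i1) \in Hom N Y by homt.
have [a aH ag] := exact_colift ex (Ext0_adds_l MN MX) eH.
have fg : f ** g = 0 by case: ex => _ _ [? [? []]].
have [|q qH qf] := exact_lift ex (homM fH aH).
  by rewrite -fmulA ag fmulA fg fmul0.
have [c qc] := End_scalar indX XX qH.
have [||d dH gd] := exact_desc (x := a - c *: \1_N) ex; first by homt.
  by rewrite fmulBr -qf qc fmulZl fmul1 fmulZr fmulr1 subrr.
have dg : d ** g = p1 ** i1 - c *: \1_Y.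
  apply: (epi_inj (exact_epi ex)).
  by rewrite fmulA gd fmulBl ag fmulZl fmul1 fmulBr fmulZr fmulr1.
have [c0|c0] := eqVneq c 0.
  left; apply: (nosum _ i1 p1) => //.
  apply: (adds_split (x := i1 ** d) (y := g ** p1)) MN; homt.
  rewrite fmulA -(fmulA i1) dg c0 scale0r subr0.
  by rewrite fmulA ip1 fmul1.
right; apply: (nosum _ i2 p2) => //.
apply: (adds_split (x := - c^-1 *: (i2 ** d)) (y := g ** p2)) MN; homt.
rewrite fmulZl fmulA -(fmulA i2) dg fmulBr fmulZr fmulr1 fmulA i2p1 fmul0 sub0r.
by rewrite fmulNl fmulZl ip2 scalerN scaleNr opprK scalerA mulVf // scale1r.
Qed.

(** Each sequence maps to the other over the identity of X, inducing u : Y1 -> Y2 and v : Y2 -> Y1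
    with u v a scalar. If it is 0, the composite a b : N1 -> N1 lands in X and retracts f1, so X
    lies in add M; otherwise Y1 is a summand of Y2. *)
Lemma exchange_unique M X Y1 Y2 : ~ adds M X ->
  indecomposable Y1 -> indecomposable Y2 -> Ext0 Y1 Y1 -> Ext0 Y1 M -> Ext0 Y2 M ->
  exchange M X Y1 -> exchange M X Y2 -> iso Y1 Y2.
Proof.
move=> nX ind1 ind2 YY1 Y1M Y2M [N1 [f1 [g1 [MN1 ex1]]]] [N2 [f2 [g2 [MN2 ex2]]]].
have [f1H g1H _] := ex1; have [f2H g2H _] := ex2.
have fg1 : f1 ** g1 = 0 by case: ex1 => _ _ [? [? []]].
have fg2 : f2 ** g2 = 0 by case: ex2 => _ _ [? [? []]].
have [a aH aE] := exact_extend ex1 (Ext0_adds_r MN2 Y1M) f2H.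
have [b bH bE] := exact_extend ex2 (Ext0_adds_r MN1 Y2M) f1H.
have [|u uH uE] := exact_desc ex1 (homM aH g2H); first by rewrite fmulA aE.
have [|v vH vE] := exact_desc ex2 (homM bH g1H); first by rewrite fmulA bE.
have [c cE] := End_scalar ind1 YY1 (homM uH vH).
have [c0|c0] := eqVneq c 0.
  case: nX; have [|q qH qE] := exact_lift ex1 (homM aH bH).
    by rewrite -fmulA -vE fmulA -uE -fmulA cE c0 scale0r fmulr0.
  apply: (adds_split f1H qH) MN1; apply: (mono_inj (exact_mono ex1)).
  by rewrite -fmulA qE fmulA aE bE fmul1.
apply: (indec_summand ind2 (homZ c^-1 uH) vH _ (indec_neq0 ind1)).
by rewrite fmulZl cE scalerA mulVf // scale1r.
Qed.

(** If X is cogenerated, the cokernel Y of its left approximation has Ext^1(Y, M) = 0; if X is also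
    a quotient of a module in add M, then Ext^1(Y, X) = 0 and the sequence splits. *)
Lemma gen_cogen_split M X : Ext0 M M -> gen M X -> cogen M X -> adds M X.
Proof.
move=> MM [N' [q [MN' eq]]] [N0 [j0 [MN0 [j0H [j0' jj]]]]].
apply: NNPP => nX; have [m [f [fH fE]]] := left_approx M X.
have mf : mono f.
  split=> //; have [h' _ h'E] := fE _ _ MN0 j0H.
  by exists (h' ** j0'); rewrite fmulA h'E.
have [Y [g ex]] := mono_exact mf.
have YM : Ext0 Y M.
  apply: exact_Ext0_coker ex (Ext0_adds_l (adds_copies M m) MM) _ => h hH.
  by apply: fE => //; apply: adds_refl.
have exY : exchange M X Y by exists (copies m M), f, g; split=> //; apply: adds_copies.
exact: exchange_nonsplit nX exY (Ext0_epi eq (Ext0_adds_r MN' YM)).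
Qed.

Lemma fac_epi_gen M U X (x : C0 U X) : fac M x -> epi x -> gen M X.
Proof.
move=> [m [u [v [uH vH e]]]] [_ [z zx]].
have [a [b [aH bH ab]]] := copies_sum uH vH.
exists (copies m M), b; split; first exact: adds_copies.
by split=> //; exists (z ** a); rewrite -fmulA ab -e.
Qed.

(* The columns of the matrix C record the X-components of maps X -> E -> (M + X)^m; a relation
   between them yields an epimorphism onto X factoring through add M. *)
Lemma gen_or_lift M X E K m (b : C0 E (copies m (dsum M X))) : indecomposable X -> Ext0 X X ->
  adds (dsum M X) E -> epi b -> (forall h, h \in Hom K M -> h = 0) ->
  gen M X \/ forall h, h \in Hom K (copies m (dsum M X)) -> exists2 h', h' \in Hom K E & h' ** b = h.
Proof.
move=> indX XX TE [bH [b' bb]] KM.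
set T := dsum M X in b bH b' bb TE *.
have [i [p [iH pH _ diag off one]]] := copies_biproduct m T.
pose q l : C0 (copies m T) X := p l ** prr M X.
pose w l : C0 X (copies m T) := inr M X ** i l.
have qH l : q l \in Hom (copies m T) X by rewrite /q; homt.
have wH l : w l \in Hom X (copies m T) by rewrite /w; homt.
have wq l l' : w l ** q l' = (l == l')%:R *: \1_X.
  rewrite fmul_mid; have [->|ll] := eqVneq l l'.
    by rewrite diag ?mem_enum // fmulr1 inr_prr scale1r.
  by rewrite off // fmulr0 fmul0 scale0r.
have [d [e [eH eE]]] := hom_basis X E.
have [C CE] : exists C : 'M[F]_(d, m), forall k l, e k ** b ** q l = C k l *: \1_X.
  have H k : exists c : 'I_m -> F, forall l, e k ** b ** q l = c l *: \1_X.
    apply: (fin_all_exists (P := fun l c => e k ** b ** q l = c *: \1_X)) => l.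
    by apply: (End_scalar indX XX); homt.
  by have [c cE] := fin_all_exists H; exists (\matrix_(k, l) c k l) => k l; rewrite mxE.
case Cfull: (row_full C).
  (* A left inverse D of C combines the e_k into maps X -> E whose X-components are unit vectors. As
     Hom(K, M) = 0, a map from K to the copies is determined by its X-components and lifts through
     these. *)
  right; have /row_fullP [D DC] := Cfull.
  pose w' l : C0 X E := \sum_k D l k *: e k.
  have w'H l : w' l \in Hom X E by apply: hom_sum => k _; homt.
  have w'q l l' : w' l ** b ** q l' = (l == l')%:R *: \1_X.
    rewrite /w' !fmul_suml; under eq_bigr => k _ do rewrite !fmulZl CE scalerA.
    by rewrite -scaler_suml; have /matrixP/(_ l l') := DC; rewrite !mxE => ->.
  have KE h : h \in Hom K (copies m T) -> h = \sum_l h ** q l ** w l.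
    move=> hH; rewrite -[LHS]fmulr1 -one big_enum fmul_sumr; apply: eq_bigr => l _.
    rewrite /q /w fmulA -(fmulr1 (h ** p l)) -[\1_T]dsum1 fmulDr fmulDl !fmulA.
    by rewrite (KM (h ** p l ** prl M X)) ?fmul0 ?add0r //; homt.
  move=> h hH; exists (\sum_l h ** q l ** w' l).
    by apply: hom_sum => l _; homt.
  rewrite [RHS]KE // [LHS]KE; last first.
    by apply: homM => //; apply: hom_sum => l _; homt.
  apply: eq_bigr => l _; congr (_ ** _).
  rewrite !fmul_suml (bigD1 l) //= big1 => [|l' ll].
    by rewrite -(fmulA _ (w' l) b) -(fmulA _ (w' l ** b)) w'q eqxx scale1r fmulr1 addr0.
  by rewrite -(fmulA _ (w' l') b) -(fmulA _ (w' l' ** b)) w'q (negbTE ll) scale0r fmulr0.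
left; have : kermx C^T != 0 by rewrite kermx_eq0 /row_free mxrank_tr -/(row_full C) Cfull.
case/rowV0Pn => v /sub_kermxP vC v0.
pose q0 : C0 (copies m T) X := \sum_l v 0 l *: q l.
have q0H : q0 \in Hom (copies m T) X by apply: hom_sum => l _; homt.
have eq0 x : x \in Hom X E -> x ** b ** q0 = 0.
  move=> /eE [a ->]; rewrite !fmul_suml big1 // => k _.
  rewrite !fmulZl /q0 fmul_sumr; under eq_bigr => l _ do rewrite fmulZr CE scalerA.
  rewrite -scaler_suml; have /rowP/(_ k) := vC; rewrite !mxE.
  by under eq_bigr => l _ do rewrite mxE; move=> ->; rewrite scale0r scaler0.
have [l vl] : exists l, v 0 l != 0.
  apply/existsP; apply: contraNT v0 => /existsPn H; apply/eqP/rowP => l; rewrite mxE.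
  by have := H l; rewrite negbK => /eqP.
have wq0 : w l ** q0 = v 0 l *: \1_X.
  rewrite /q0 fmul_sumr (bigD1 l) //= big1 => [|l' ll]; rewrite fmulZr wq.
    by rewrite eqxx scale1r addr0.
  by rewrite eq_sym (negbTE ll) scale0r scaler0.
apply: (fac_epi_gen (x := b ** q0)); last first.
  split; homt; exists ((v 0 l)^-1 *: w l ** b').
  by rewrite fmul_mid bb fmulr1 fmulZl wq0 scalerA mulVf // scale1r.
have [r [x [y [xH yH one']]]] := TE.
rewrite -[b]fmul1 one' !fmul_suml; apply: fac_sum => k _.
rewrite -[x k]fmulr1 -[fone F _]dsum1 fmulDr !fmulDl; apply: facD.
  rewrite -!fmulA !(fmulA (x k)); apply: fac_comp; homt.
have -> : x k ** (prr M X ** inr M X) ** y k ** b ** q0 =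
    x k ** prr M X ** ((inr M X ** y k) ** b ** q0) by rewrite !fmulA.
by rewrite eq0 ?fmulr0; [exact: fac0 | homt].
Qed.

Definition simple (v : 'I_n) : rep :=
  @Rep F n Ar s t (fun j => (j == v) : nat) (fun a => 0).

(** The form sees only the dimension vector of W, which is that of the sum of simples. *)
Lemma euler_simple K W : euler K W = \sum_v (rdim W v)%:R * euler K (simple v).
Proof.
rewrite /euler; under [RHS]eq_bigr => v _ do rewrite mulrBr.
rewrite sumrB; congr (_ - _).
  apply: eq_bigr => v _; rewrite (bigD1 v) //= eqxx mulr1 big1 ?addr0 1?mulrC // => j jv.
  by rewrite (negbTE jv) mulr0.
under [RHS]eq_bigr => v _ do rewrite mulr_sumr.
rewrite exchange_big; apply: eq_bigr => a _; rewrite (bigD1 (t a)) //= eqxx mulr1.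
by rewrite big1 ?addr0 1?mulrC // => v /negbTE; rewrite eq_sym => ->; rewrite !mulr0.
Qed.

(** Here 0 = <K, M> is the sum of (dim M)_v dim Hom(K, S_v) with all (dim M)_v > 0, so each Hom(K,
    S_v) is 0. Expanding <K, K> in the same way gives End(K) = 0. *)
Lemma sincere_hom K M : (forall W, Ext0 K W) -> (forall v, 0 < rdim M v)%N ->
  (forall h, h \in Hom K M -> h = 0) -> \1_K = 0.
Proof.
move=> KW sinc KM.
have simp0 v : hdim K (simple v) = 0%N.
  have := euler_simple K M; rewrite eulerE // (hdim0 KM) => /esym.
  under eq_bigr => u _ do rewrite eulerE // -natrM.
  rewrite -natr_sum => /eqP; rewrite Num.Theory.pnatr_eq0 sum_nat_eq0 => /forallP/(_ v).
  by rewrite /= muln_eq0 eqn0Ngt sinc => /eqP.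
apply: (@hdim_eq0 _ _ _ _ _ K K); last exact: hom1.
apply/eqP; rewrite -(Num.Theory.pnatr_eq0 rat) -eulerE // euler_simple big1 // => v _.
by rewrite eulerE // simp0 mulr0.
Qed.

Lemma gen_or_cogen M X : acyclic s t -> indecomposable X -> maximal_rigid (dsum M X) ->
  (forall v, 0 < rdim M v)%N -> gen M X \/ cogen M X.
Proof.
move=> hQ indX maxT sinc; have [TT _] := maxT.
have TM := adds_dsuml M X; have TX := adds_dsumr M X.
have MM : Ext0 M M := Ext0_adds TM TM TT.
have XM : Ext0 X M := Ext0_adds TX TM TT.
have XX : Ext0 X X := Ext0_adds TX TX TT.
have [m [f [fH fE]]] := left_approx M X.
have [I [p [i [ep mi pi]]]] := hom_image fH.
have [K [k ex]] := epi_exact ep.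
have kp : k ** p = 0 by case: ex => _ _ [? [? []]].
have IM : Ext0 I M := Ext0_mono mi (Ext0_adds_l (adds_copies M m) MM).
(* A map K -> M extends to X because Ext^1(I, M) = 0, and the extension factors through f, which
   kills K. *)
have KM h : h \in Hom K M -> h = 0.
  move=> hH; have [h' h'H <-] := exact_extend ex IM hH.
  have [h2 _ <-] := fE _ _ (adds_refl M) h'H.
  by rewrite -pi !fmulA kp !fmul0.
have mk := exact_mono ex.
have KT : Ext0 K (dsum M X) by apply: Ext0_dsumr; apply: Ext0_mono mk _.
have [m' [E [a [b [exE TE]]]]] := maximal_bongartz (@regular_Ext0 F n Ar s t hQ) maxT.
have [|lift] := gen_or_lift indX XX TE (exact_epi exE) KM; [by left | right].
(* K embeds into X, so Ext^1(K, E) = 0; with the lifting of maps K -> T^m', Bongartz' sequence of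
   the regular module gives Ext^1(K, kQ) = 0. *)
have KR : Ext0 K (regular_rep F s t).
  exact: exact_Ext0_ker exE (Ext0_adds_r TE KT) lift.
have KW W : Ext0 K W.
  have [l [g eg]] := regular_cover hQ W.
  exact: Ext0_epi eg (Ext0_adds_r (adds_copies _ l) KR).
have K0 := sincere_hom KW sinc KM.
exists (copies m M), f; split; first exact: adds_copies.
split=> //; have [_ [i' ii]] := mi; have [_ _ [k' [p' [_ _ _ e]]]] := ex.
exists (i' ** p'); rewrite -pi fmul_mid ii fmulr1 -e.
by rewrite -[k]fmul1 K0 fmul0 fmulr0 add0r.
Qed.

End Exchange.

(** * Vector space duality with the opposite quiver *)

Section Transpose.
Set Implicit Arguments. Unset Strict Implicit. Unset Printing Implicit Defensive.
Import GRing.Theory.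
Local Open Scope ring_scope.
Local Open Scope fam_scope.
Variables (F : closedFieldType) (n : nat) (Ar : finType) (s t : Ar -> 'I_n).
Local Notation rep := (rep F s t).
Local Notation C0 V W := (fam F (rdim V) (rdim W)).
Local Notation C1 V W := (fam F (fun a => rdim V (s a)) (fun a => rdim W (t a))).
Local Notation "\1_ V" := (fone F (rdim V)) (at level 8, V at level 2).
Implicit Types U V W X Y Z M N P E K : rep.

Definition ftr (J : finType) (p q : J -> nat) (x : fam F p q) : fam F q p :=
  mkfam (fun j => (fmx x j)^T).

Lemma ftrK (J : finType) (p q : J -> nat) : cancel (@ftr J p q) (@ftr J q p).
Proof. by move=> x; apply: famP => j; rewrite !fmxE trmxK. Qed.
Lemma ftrM (J : finType) (p q r : J -> nat) (x : fam F p q) (y : fam F q r) :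
  ftr (x ** y) = ftr y ** ftr x.
Proof. by apply: famP => j; rewrite !fmxE trmx_mul. Qed.
Lemma ftrD (J : finType) (p q : J -> nat) (x y : fam F p q) : ftr (x + y) = ftr x + ftr y.
Proof. by apply: famP => j; rewrite !fmxE raddfD. Qed.
Lemma ftr0 (J : finType) (p q : J -> nat) : ftr (0 : fam F p q) = 0.
Proof. by apply: famP => j; rewrite !fmxE trmx0. Qed.
Lemma ftr1 (J : finType) (p : J -> nat) : ftr (fone F p) = fone F p.
Proof. by apply: famP => j; rewrite !fmxE trmx1. Qed.
Lemma ftrN (J : finType) (p q : J -> nat) (x : fam F p q) : ftr (- x) = - ftr x.
Proof. by apply: famP => j; rewrite !fmxE raddfN. Qed.

(** The dual representation Hom(V, k), in dual bases. *)
Definition op V : Defs.rep F t s := @Rep F n Ar t s (rdim V) (fun a => (rmap V a)^T).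

Lemma ftr_diff V W (x : C0 V W) : @diff F n Ar t s (op W) (op V) (ftr x) = - ftr (diff x).
Proof.
by apply: famP => a; rewrite !fmxE /= raddfB opprB /= !trmx_mul.
Qed.
Lemma ftr_hom V W (x : C0 V W) : x \in Hom V W -> (ftr x : fam F (rdim (op W)) (rdim (op V))) \in Hom (op W) (op V).
Proof. by move=> /homP H; apply/homP; rewrite ftr_diff H ftr0 oppr0. Qed.

Lemma op_Ext0 V W : Ext0 V W -> Ext0 (op W) (op V).
Proof.
move=> VW c; have [x xE] := VW (- ftr c).
by exists (ftr x); rewrite ftr_diff xE ftrN opprK ftrK.
Qed.

Lemma op_exact X E Y (f : C0 X E) (g : C0 E Y) : exact f g ->
  @exact F n Ar t s (op Y) (op E) (op X) (ftr g) (ftr f).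
Proof.
move=> [fH gH [f' [g' [ff gg fg e]]]]; split; try exact: ftr_hom.
exists (ftr g'), (ftr f'); rewrite -!ftrM -ftrD ff gg fg ftr0 !ftr1; split=> //.
by rewrite addrC e ftr1.
Qed.

Lemma op_iso V W : iso V W -> iso (op V) (op W).
Proof.
move=> /isoE [x [y [xH yH xy yx]]]; apply/isoE; exists (ftr y), (ftr x).
by rewrite -!ftrM xy yx !ftr1; split=> //; apply: ftr_hom.
Qed.

Lemma op_adds M X : adds M X -> adds (op M) (op X).
Proof.
move=> [m [u [v [uH vH e]]]]; rewrite /adds -[fone _ _]ftr1 e.
rewrite (big_morph (@ftr _ _ _) (@ftrD _ _ _) (@ftr0 _ _ _)).
apply: fac_sum => i _; rewrite ftrM; apply: (@fac_comp _ _ _ _ _ (op M) (op X) (op X));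
exact: ftr_hom.
Qed.

Lemma op_epi N X (f : C0 N X) : epi f -> @mono F n Ar t s (op X) (op N) (ftr f).
Proof.
move=> [fH [y fy]]; split; first exact: ftr_hom.
by exists (ftr y); rewrite -ftrM fy ftr1.
Qed.
Lemma op_gen M X : gen M X -> cogen (op M) (op X).
Proof.
by move=> [N [g [MN eg]]]; exists (op N), (ftr g); split; [exact: op_adds | exact: op_epi].
Qed.
Lemma op_exchange M X Y : exchange M X Y -> exchange (op M) (op Y) (op X).
Proof.
move=> [N [f [g [MN ex]]]]; exists (op N), (ftr g), (ftr f).
by split; [exact: op_adds | exact: op_exact].
Qed.

(** An equality and not only an isomorphism: the dimensions agree by computation, so only the maps
    are compared and no transport arises. *)
Lemma op_dsum V W : op (dsum V W) = dsum (op V) (op W).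
Proof.
rewrite /op /dsum /=; congr Rep; apply: functional_extensionality_dep => a.
by rewrite tr_block_mx !trmx0.
Qed.

End Transpose.

(** * Double duality *)

Section OpInvolution.
Set Implicit Arguments. Unset Strict Implicit. Unset Printing Implicit Defensive.
Variables (F : closedFieldType) (n : nat) (Ar : finType) (s t : Ar -> 'I_n).

Lemma opK (V : rep F s t) : op (op V) = V.
Proof.
case: V => d m; rewrite /op /=; congr Rep; apply: functional_extensionality_dep => a.
exact: trmxK.
Qed.

Lemma op_indec (V : rep F s t) : indecomposable V -> indecomposable (op V).
Proof.
move=> [nz ind]; split=> [H|Z1 Z2 /op_iso]; first exact: nz.
by rewrite opK op_dsum => /ind.
Qed.

End OpInvolution.

(** * Exchange sequences ending at X *)

Section Duality.
Set Implicit Arguments. Unset Strict Implicit. Unset Printing Implicit Defensive.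
Import GRing.Theory.
Local Open Scope ring_scope.
Local Open Scope fam_scope.
Variables (F : closedFieldType) (n : nat) (Ar : finType) (s t : Ar -> 'I_n).
Local Notation rep := (rep F s t).
Local Notation C0 V W := (fam F (rdim V) (rdim W)).
Local Notation "\1_ V" := (fone F (rdim V)) (at level 8, V at level 2).
Implicit Types U V W X Y Z M N P E K : rep.

Lemma coexchange_exists M X : indecomposable X -> ~ adds M X ->
  Ext0 M M -> Ext0 M X -> Ext0 X M -> Ext0 X X -> gen M X ->
  exists Y, [/\ indecomposable Y, ~ adds M Y, Ext0 Y M /\ Ext0 M Y, Ext0 Y Y & exchange M Y X].
Proof.
move=> indX nX MM MX XM XX /op_gen gX.
have nX' : ~ adds (op M) (op X) by move=> /op_adds; rewrite !opK.
have [Y [iY nY [YM MY] YY ex]] := exchange_exists (op_indec indX) nX' (op_Ext0 MM)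
  (op_Ext0 XM) (op_Ext0 MX) (op_Ext0 XX) gX.
exists (op Y); split.
- exact: op_indec.
- by move=> /op_adds; rewrite opK.
- by split; rewrite -[M]opK; apply: op_Ext0.
- exact: op_Ext0.
by have := op_exchange ex; rewrite !opK.
Qed.

Lemma coexchange_unique M X Y1 Y2 : ~ adds M X ->
  indecomposable Y1 -> indecomposable Y2 -> Ext0 Y1 Y1 -> Ext0 M Y1 -> Ext0 M Y2 ->
  exchange M Y1 X -> exchange M Y2 X -> iso Y1 Y2.
Proof.
move=> nX i1 i2 E1 M1 M2 ex1 ex2; rewrite -[Y1]opK -[Y2]opK; apply: op_iso.
apply: (@exchange_unique _ _ _ _ _ (op M) (op X)); try exact: op_indec; try exact: op_Ext0;
  try exact: op_exchange.
by move=> /op_adds; rewrite !opK.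
Qed.

End Duality.

(** * Cancellation, counting of isomorphism classes, and the arrows at T *)

Section Mutations.
Set Implicit Arguments. Unset Strict Implicit. Unset Printing Implicit Defensive.
Import GRing.Theory.
Local Open Scope ring_scope.
Local Open Scope fam_scope.
Variables (F : closedFieldType) (n : nat) (Ar : finType) (s t : Ar -> 'I_n).
Local Notation rep := (rep F s t).
Local Notation C0 V W := (fam F (rdim V) (rdim W)).
Local Notation "\1_ V" := (fone F (rdim V)) (at level 8, V at level 2).
Implicit Types U V W X Y Z M N P E K : rep.

Lemma dsumC V W : iso (dsum V W) (dsum W V).
Proof.
apply: (split_iso (x := inr V W) (y := prr V W) (i := inl V W) (u := prl V W)); homt.
- exact: inr_prr.
- exact: inl_prl.
- exact: inr_prl.
- exact: inl_prr.
by rewrite addrC dsum1.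
Qed.

Lemma dsum_iso V W V' W' : iso V V' -> iso W W' -> iso (dsum V W) (dsum V' W').
Proof.
move=> /isoE [x [x' [xH xH' xx xx']]] /isoE [y [y' [yH yH' yy yy']]].
apply: (split_iso (x := x' ** inl V W) (y := prl V W ** x) (i := y' ** inr V W) (u := prr V W ** y)); homt.
- by rewrite fmul_mid inl_prl fmulr1.
- by rewrite fmul_mid inr_prr fmulr1.
- by rewrite fmul_mid inl_prr fmulr0 fmul0.
- by rewrite fmul_mid inr_prl fmulr0 fmul0.
by rewrite !fmul_mid xx yy !fmulr1 dsum1.
Qed.

(** Write the isomorphism as a 2 x 2 matrix (p, q; r, a). Once the entry a : X -> X is invertible,
    the Schur complement p - q a' r is an isomorphism N -> M, with inverse the corner p' of the
    inverse matrix. *)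
Lemma dsum_cancel N M X : indecomposable X -> Ext0 X X -> ~ adds M X ->
  iso (dsum N X) (dsum M X) -> iso N M.
Proof.
move=> indX XX nX /isoE [f [g [fH gH fg gf]]].
pose p := inl N X ** f ** prl M X; pose q := inl N X ** f ** prr M X.
pose r := inr N X ** f ** prl M X; pose a := inr N X ** f ** prr M X.
pose p' := inl M X ** g ** prl N X; pose q' := inl M X ** g ** prr N X.
pose r' := inr M X ** g ** prl N X; pose a' := inr M X ** g ** prr N X.
have fE (W W' : rep) (u : C0 W (dsum N X)) (v : C0 (dsum N X) W') :
    u ** f ** prl M X ** (inl M X ** g ** v) + u ** f ** prr M X ** (inr M X ** g ** v) = u ** v.
  have <- : u ** f ** \1_(dsum M X) ** g ** v = u ** v by rewrite fmulr1 -(fmulA u) fg fmulr1.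
  by rewrite -dsum1 fmulDr !fmulDl !fmulA.
have gE (W W' : rep) (u : C0 W (dsum M X)) (v : C0 (dsum M X) W') :
    u ** g ** prl N X ** (inl N X ** f ** v) + u ** g ** prr N X ** (inr N X ** f ** v) = u ** v.
  have <- : u ** g ** \1_(dsum N X) ** f ** v = u ** v by rewrite fmulr1 -(fmulA u) gf fmulr1.
  by rewrite -dsum1 fmulDr !fmulDl !fmulA.
have [pH qH rH aH] : [/\ p \in Hom N M, q \in Hom N X, r \in Hom X M & a \in Hom X X].
  by split; rewrite /p /q /r /a; homt.
have [pH' qH' rH' aH'] : [/\ p' \in Hom M N, q' \in Hom M X, r' \in Hom X N & a' \in Hom X X].
  by split; rewrite /p' /q' /r' /a'; homt.
have e1 : r ** q' + a ** a' = \1_X by rewrite fE inr_prr.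
have e2 : p' ** p + q' ** r = \1_M by rewrite gE inl_prl.
have e3 : p' ** q + q' ** a = 0 by rewrite gE inl_prr.
have e4 : p ** p' + q ** r' = \1_N by rewrite fE inl_prl.
have e5 : r ** p' + a ** r' = 0 by rewrite fE inr_prl.
(* r q' is a scalar endomorphism of X through M; were it nonzero, X would lie in add M. *)
have aa : a ** a' = \1_X.
  have [c cE] := End_scalar indX XX (homM rH qH').
  have [c0|c0] := eqVneq c 0; first by rewrite -e1 cE c0 scale0r add0r.
  case: nX; apply: (adds_split (homZ c^-1 rH) qH' _ (adds_refl M)).
  by rewrite fmulZl cE scalerA mulVf // scale1r.
have a'a : a' ** a = \1_X by apply: fmul1C aa.
clearbody p q r a p' q' r' a'.
apply/isoE; exists (p - q ** a' ** r), p'; split; homt.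
  rewrite fmulBl -e4; congr (_ + _).
  have -> : r' = - (a' ** r ** p').
    apply/eqP; rewrite -addr_eq0 -[r']fmul1 -a'a -!(fmulA a').
    by rewrite -fmulDr addrC e5 fmulr0.
  by rewrite fmulNr !fmulA.
rewrite fmulBr -e2; congr (_ + _).
have -> : q' = - (p' ** q ** a').
  apply/eqP; rewrite -addr_eq0 -[q']fmulr1 -aa fmulA.
  by rewrite -fmulDl addrC e3 fmul0.
by rewrite fmulNl !fmulA.
Qed.

Lemma exchange_iso M X Y M' X' Y' : iso M M' -> iso X X' -> iso Y Y' ->
  exchange M X Y -> exchange M' X' Y'.
Proof.
move=> MM /isoE [x [x' [xH xH' xx xx']]] /isoE [y [y' [yH yH' yy yy']]].
move=> [N [f [g [MN [fH gH [f' [g' [ff gg fg e]]]]]]]].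
exists N, (x' ** f), (g ** y); split.
  exact: adds_trans (adds_iso (iso_sym MM) (adds_refl _)) MN.
split; homt; exists (f' ** x), (y' ** g'); split.
- by rewrite fmul_mid ff fmulr1.
- by rewrite fmul_mid gg fmulr1.
- by rewrite fmul_mid fg fmulr0 fmul0.
by rewrite !fmul_mid xx yy !fmulr1.
Qed.

Lemma exchange_inE M X Y : exchange M X Y <->
  exists M' (f : hom X M') (g : hom M' Y), in_add M M' /\ ses f g.
Proof.
split=> [[N [f [g [MN ex]]]]|[N [f [g [/in_addE MN /ses_exact ex]]]]].
  by exists N, (fmx f), (fmx g); split; [apply/in_addE | exact: exact_ses].
by exists N, (mkfam f), (mkfam g).
Qed.

Lemma basic_of_family (J : eqType) (r : seq J) (X : J -> rep) T : uniq r ->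
  (forall j, j \in r -> indecomposable (X j)) ->
  (forall j k, j \in r -> k \in r -> j != k -> ~ iso (X j) (X k)) ->
  iso T (dsum_list [seq X j | j <- r]) -> basic T.
Proof.
case: r => [|j0 r0]; first by move=> _ _ _ H; exists [::]; split=> // k l /andP [_].
set r := j0 :: r0 => ur indX isoX TX; exists [seq X j | j <- r]; split=> // [k|k l].
  by rewrite size_map => kr; rewrite (nth_map j0) //; apply: indX; apply: mem_nth.
rewrite size_map => /andP [kl lr]; have kr := ltn_trans kl lr.
rewrite !(nth_map j0) //; apply: isoX; rewrite ?mem_nth // nth_uniq //.
by rewrite neq_ltn kl.
Qed.

Lemma family_of_basic T : basic T -> exists (m : nat) (X : 'I_m -> rep),
  [/\ forall j, indecomposable (X j), forall j k, j != k -> ~ iso (X j) (X k)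
    & iso T (dsum_list [seq X j | j <- enum 'I_m])].
Proof.
move=> [Ts [ind niso TX]]; exists (size Ts), (fun j => nth (zero_rep F s t) Ts j).
split=> [j|j k jk|]; first exact: ind.
  have [lt|lt|/val_inj e] := ltngtP j k; last by rewrite e eqxx in jk.
    by apply: niso; rewrite lt ltn_ord.
  by move=> /iso_sym; apply: niso; rewrite lt ltn_ord.
suff -> : [seq nth (zero_rep F s t) Ts (j : 'I__) | j <- enum 'I_(size Ts)] = Ts by [].
apply: (@eq_from_nth _ (zero_rep F s t)); rewrite size_map size_enum_ord // => k kT.
by rewrite (nth_map (Ordinal kT)) ?size_enum_ord // nth_enum_ord.
Qed.

Lemma num_iso_intro (P : rep -> Prop) (J : finType) (S : pred J) (V : J -> rep) :
  (forall j, S j -> P (V j)) -> (forall j k, S j -> S k -> j != k -> ~ iso (V j) (V k)) ->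
  (forall W, P W -> exists2 j, S j & iso W (V j)) -> num_iso_classes P #|S|.
Proof.
move=> PV nisoV exV; exists [seq V j | j <- enum S].
have sz : size [seq V j | j <- enum S] = #|S| by rewrite size_map -cardE.
have nthE k : (k < #|S|)%N -> exists2 j, S j & nth (zero_rep F s t) [seq V j | j <- enum S] k = V j
    /\ index j (enum S) = k.
  rewrite cardE => kS; case E : (enum S) kS => [//|j0 r] kS; rewrite -E in kS *.
  exists (nth j0 (enum S) k); first by have := mem_nth j0 kS; rewrite mem_enum.
  by rewrite (nth_map j0) // index_uniq // enum_uniq.
split=> // [k /nthE [j jS [-> _]]|k l /andP [kl lS]|W /exV [j jS Wj]]; first exact: PV.
  have [j jS [-> jk]] := nthE k (ltn_trans kl lS); have [j' jS' [-> jl]] := nthE l lS.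
  apply: nisoV => //; apply/eqP => e; move: kl; rewrite -jk -jl e ltnn //.
have jE : j \in enum S by rewrite mem_enum.
exists (index j (enum S)); first by rewrite cardE index_mem.
by rewrite (nth_map j) ?index_mem // nth_index.
Qed.

(** [saturated] only asserts that some counts exist; this makes them the computed ones. *)
Lemma num_iso_unique (P : rep -> Prop) c c' :
  num_iso_classes P c -> num_iso_classes P c' -> c = c'.
Proof.
suff le c1 c2 : num_iso_classes P c1 -> num_iso_classes P c2 -> (c1 <= c2)%N.
  by move=> H H'; apply/eqP; rewrite eqn_leq !le.
move=> [L [_ PL nisoL _]] [L' [_ _ _ exL']].
have [f fE] : exists f : 'I_c1 -> 'I_c2, forall k : 'I_c1, iso (nth (zero_rep F s t) L k) (nth (zero_rep F s t) L' (f k)).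
  apply: (fin_all_exists (P := fun (k : 'I_c1) (l : 'I_c2) =>
     iso (nth (zero_rep F s t) L k) (nth (zero_rep F s t) L' l))) => k.
  by have [l lc H] := exL' _ (PL k (ltn_ord k)); exists (Ordinal lc).
have finj : injective f.
  move=> k l fkl; apply: val_inj; apply/eqP; apply: contraT => kl.
  have H : iso (nth (zero_rep F s t) L k) (nth (zero_rep F s t) L l).
    by apply: iso_trans (fE k) _; rewrite fkl; apply: iso_sym.
  have := ltn_ord l; have := ltn_ord k; move: kl H; rewrite neq_ltn => /orP [lt|lt] H kc lc.
    by case: (nisoL k l); rewrite ?lt.
  by case: (nisoL l k); rewrite ?lt //; apply: iso_sym.
by have := leq_card f finj; rewrite !card_ord.
Qed.

Lemma adds_dim0 M N v : adds M N -> rdim M v = 0%N -> rdim N v = 0%N.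
Proof.
move=> /in_addE [m /summand_split [x [y [_ _ xy]]]] Mv.
apply/eqP; rewrite -leqn0 (leq_trans (fmono_le xy v)) // leqn0 /copies.
by elim: m {x y xy} => [//|m IH] /=; rewrite Mv add0n.
Qed.

Lemma maximal_iso M N : iso M N -> maximal_rigid M -> maximal_rigid N.
Proof.
move=> MN [MM max]; have NM := adds_iso (iso_sym MN) (adds_refl N).
have MN' := adds_iso MN (adds_refl M).
split=> [|Z NZ ZN ZZ]; first exact: (Ext0_adds MN' MN' MM).
apply: (adds_trans NM (max _ _ _ ZZ)); [exact: Ext0_adds_l NM NZ | exact: Ext0_adds_r NM ZN].
Qed.

(** * The complements of the summands of a basic tilting module *)

Section TiltingFamily.
Hypothesis hQ : acyclic s t.
Variables (m : nat) (X : 'I_m -> rep) (T : rep).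
Local Notation J := 'I_m.
Hypotheses (indX : forall j, indecomposable (X j)) (isoX : forall i j, i != j -> ~ iso (X i) (X j)).
Hypothesis (TX : iso T (dsum_list [seq X j | j <- enum J])).
Hypothesis (tT : basic_tilting T).

Let others (j : J) : seq J := [seq k <- enum J | k != j].
Definition cpl (j : J) : rep := dsum_list [seq X k | k <- others j].

Let others_uniq j : uniq (others j). Proof. exact/filter_uniq/enum_uniq. Qed.
Let mem_others j k : (k \in others j) = (k != j).
Proof. by rewrite mem_filter mem_enum andbT. Qed.
Let cons_others_uniq j : uniq (j :: others j).
Proof. by rewrite /= mem_others eqxx others_uniq. Qed.
Let perm_others j : perm_eq (enum J) (j :: others j).
Proof.
apply: uniq_perm; rewrite ?enum_uniq // => k.
by rewrite mem_enum in_cons mem_others orbN.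
Qed.

Lemma T_cpl j : iso T (dsum (cpl j) (X j)).
Proof.
apply: iso_trans TX _; apply: iso_trans (dsumC _ _).
exact: dsum_list_iso (enum_uniq J) (perm_others j).
Qed.

Lemma T_biproduct : exists i p, @biproduct _ _ _ s t J (enum J) X T i p.
Proof.
have [i [p B]] := dsum_list_biproduct X (enum_uniq J).
exact: biproduct_transfer B (iso_sym TX).
Qed.

Lemma T_max : maximal_rigid T. Proof. by case: tT => _; apply: tilting_maximal. Qed.
Lemma T_Ext0 : Ext0 T T. Proof. by case: T_max. Qed.
Lemma T_card : m = n.
Proof.
have [i [p B]] := T_biproduct; rewrite -[LHS]card_ord.
exact: (family_card indX isoX B (@T_Ext0) hQ T_max).
Qed.

Lemma T_X j : adds T (X j).
Proof. by have [i [p B]] := T_biproduct; apply: family_adds B j. Qed.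
Lemma T_adds_cpl j : adds T (cpl j).
Proof. by apply: adds_dsum_list => k _; apply: T_X. Qed.
Lemma cpl_X j k : k != j -> adds (cpl j) (X k).
Proof.
move=> kj; have [i [p B]] := dsum_list_biproduct X (others_uniq j).
by apply: adds_biproduct B _; rewrite mem_others.
Qed.
Lemma XX j k : Ext0 (X j) (X k). Proof. exact: (Ext0_adds (T_X j) (T_X k) (@T_Ext0)). Qed.
Lemma MX j : Ext0 (cpl j) (X j). Proof. exact: (Ext0_adds (T_adds_cpl j) (T_X j) (@T_Ext0)). Qed.
Lemma XM j : Ext0 (X j) (cpl j). Proof. exact: (Ext0_adds (T_X j) (T_adds_cpl j) (@T_Ext0)). Qed.
Lemma MM j : Ext0 (cpl j) (cpl j). Proof. exact: (Ext0_adds (T_adds_cpl j) (T_adds_cpl j) (@T_Ext0)). Qed.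

Lemma cpl_nX j : ~ adds (cpl j) (X j).
Proof.
move=> H; have [i [p B]] := dsum_list_biproduct X (others_uniq j).
have [k] := krull_schmidt B (fun k _ => indX k) (indX j) (@XX j j) H.
by rewrite mem_others eq_sym => jk; apply: isoX.
Qed.

(** An arrow at T may use any decomposition of T; up to isomorphism it is one of the n standard
    ones. *)
Lemma T_decomp N Z : iso T (dsum N Z) -> indecomposable Z ->
  exists j, iso N (cpl j) /\ iso Z (X j).
Proof.
move=> TNZ indZ; have [i [p B]] := T_biproduct.
have TZ : adds T Z by apply: adds_trans (adds_iso TNZ (adds_refl T)) (adds_dsumr N Z).
have [j _ ZX] := krull_schmidt B (fun k _ => indX k) indZ (Ext0_adds TZ TZ (@T_Ext0)) TZ.
exists j; split=> //; apply: (dsum_cancel (indX j) (@XX j j) (@cpl_nX j)).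
apply: iso_trans (iso_trans (iso_sym TNZ) (T_cpl j)).
exact: dsum_iso (iso_refl N) (iso_sym ZX).
Qed.

(** Replacing X_j by Y leaves n pairwise nonisomorphic summands of a rigid module, so maximality
    follows by counting. *)
Lemma basic_tilting_cpl j Y : indecomposable Y -> ~ adds (cpl j) Y -> Ext0 Y (cpl j) ->
  Ext0 (cpl j) Y -> Ext0 Y Y -> basic_tilting (dsum Y (cpl j)).
Proof.
move=> indY nY YM MY YY.
pose X' k := if k == j then Y else X k.
have X'E : [seq X' k | k <- j :: others j] = Y :: [seq X k | k <- others j].
  rewrite /= /X' eqxx; congr (_ :: _); apply/eq_in_map => k.
  by rewrite mem_others => /negbTE ->.
have indX' k : indecomposable (X' k) by rewrite /X'; case: ifP.
have YX k : k != j -> ~ iso Y (X k).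
  by move=> kj /iso_sym H; apply/nY/(adds_iso H)/cpl_X.
have isoX' k l : k != l -> ~ iso (X' k) (X' l).
  rewrite /X'; case: (k =P j) => [->|/eqP kj]; case: (l =P j) => [->|/eqP lj].
  - by rewrite eqxx.
  - by move=> _; apply: YX.
  - by move=> _ /iso_sym; apply: YX.
  exact: isoX.
have TE : dsum Y (cpl j) = dsum_list [seq X' k | k <- j :: others j] by rewrite X'E.
split.
  apply: (basic_of_family (cons_others_uniq j) (X := X')) => // [k l _ _|]; first exact: isoX'.
  by rewrite -TE; apply: iso_refl.
apply: maximal_tilting => //.
have [i [p B]] := dsum_list_biproduct X' (cons_others_uniq j); rewrite -TE in i p B.
have B' : biproduct (enum J) i p by apply: biproduct_perm B; rewrite perm_sym.
apply: (family_maximal indX' isoX' B'); last by rewrite card_ord T_card.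
by apply: Ext0_dsumr; apply: Ext0_dsuml => //; apply: MM.
Qed.

(** * Neighbours of T, for both directions of arrows: ([exchange], [cogen]) and the reversed
    ([exchange], [gen]) *)

Section Count.
Variables (Ex : rep -> rep -> rep -> Prop) (C : rep -> rep -> Prop).
Hypothesis Ex_iso : forall M X Y M' X' Y', iso M M' -> iso X X' -> iso Y Y' ->
  Ex M X Y -> Ex M' X' Y'.
Hypothesis Ex_C : forall M X Y, Ex M X Y -> C M X.
Hypothesis Ex_nonsplit : forall M X Y, ~ adds M X -> Ex M X Y -> Ext0 X Y -> Ext0 Y X -> False.
Hypothesis Ex_exists : forall M X, indecomposable X -> ~ adds M X ->
  Ext0 M M -> Ext0 M X -> Ext0 X M -> Ext0 X X -> C M X ->
  exists Y, [/\ indecomposable Y, ~ adds M Y, Ext0 Y M /\ Ext0 M Y, Ext0 Y Y & Ex M X Y].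
Hypothesis Ex_unique : forall M X Y1 Y2, ~ adds M X -> indecomposable Y1 -> indecomposable Y2 ->
  Ext0 Y1 Y1 -> Ext0 Y1 M -> Ext0 M Y1 -> Ext0 Y2 M -> Ext0 M Y2 ->
  Ex M X Y1 -> Ex M X Y2 -> iso Y1 Y2.

Definition mutation T' : Prop := basic_tilting T' /\ exists N Z Y,
  [/\ iso T (dsum N Z), iso T' (dsum N Y), indecomposable Z, indecomposable Y & Ex N Z Y].

(** Each j in S contributes exactly one class, Y_j + M_j: existence and uniqueness of Y_j come from
    the hypotheses on [Ex]. *)
Lemma mutation_count (S : pred J) : (forall j, S j <-> C (cpl j) (X j)) ->
  num_iso_classes mutation #|S|.
Proof.
move=> SE.
have [Y YE] : exists Y : J -> rep, forall j, S j -> [/\ indecomposable (Y j), ~ adds (cpl j) (Y j),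
    Ext0 (Y j) (cpl j) /\ Ext0 (cpl j) (Y j), Ext0 (Y j) (Y j) & Ex (cpl j) (X j) (Y j)].
  apply: (fin_all_exists (P := fun j Y => S j -> [/\ indecomposable Y, ~ adds (cpl j) Y,
    Ext0 Y (cpl j) /\ Ext0 (cpl j) Y, Ext0 Y Y & Ex (cpl j) (X j) Y])) => j.
  (* Outside S the value [X j] is a placeholder. *)
  case Sj : (S j); last by exists (X j).
  have /SE CX := Sj.
  by have [Y YE] := Ex_exists (indX j) (@cpl_nX j) (@MM j) (@MX j) (@XM j) (@XX j j) CX; exists Y.
have bt j : S j -> basic_tilting (dsum (Y j) (cpl j)).
  by move=> /YE [? ? [? ?] ? ?]; apply: basic_tilting_cpl.
apply: (num_iso_intro (V := fun j => dsum (Y j) (cpl j))).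
- move=> j Sj; split; first exact: bt.
  have [indY nY [YM MY] YY ex] := YE j Sj.
  by exists (cpl j), (X j), (Y j); split=> //; [exact: T_cpl | exact: dsumC].
- move=> j k Sj Sk jk e; have [_ _ _ _ ex] := YE j Sj.
  (* For j != k the module X_j is a summand of M_k. An isomorphism would place X_j and Y_j in one
     rigid module, against the nonsplit exchange sequence between them. *)
  have [rig _] : maximal_rigid (dsum (Y j) (cpl j)) by case: (bt j Sj) => _; apply: tilting_maximal.
  have aY : adds (dsum (Y j) (cpl j)) (Y j) by apply: adds_dsuml.
  have aX : adds (dsum (Y j) (cpl j)) (X j).
    exact: adds_trans (adds_iso e (adds_refl _)) (adds_trans (adds_dsumr _ _) (cpl_X jk)).
  by apply: (Ex_nonsplit (@cpl_nX j) ex); [exact: (Ext0_adds aX aY rig) | exact: (Ext0_adds aY aX rig)].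
move=> W [[_ /(tilting_maximal hQ) [WW _]] [N [Z [Y' [TNZ WNY indZ indY' ex]]]]].
have [j [NM ZX]] := T_decomp TNZ indZ.
have {}ex := Ex_iso NM ZX (iso_refl Y') ex.
have Sj : S j by apply/SE; apply: Ex_C ex.
exists j => //; have [indY nY [YM MY] YY exY] := YE j Sj.
have WMY := iso_trans WNY (dsum_iso NM (iso_refl Y')).
have aM : adds W (cpl j) by apply: adds_trans (adds_iso WMY (adds_refl W)) (adds_dsuml _ _).
have aY : adds W Y' by apply: adds_trans (adds_iso WMY (adds_refl W)) (adds_dsumr _ _).
have YY' : iso Y' (Y j).
  apply: (Ex_unique (@cpl_nX j) indY' indY _ _ _ YM MY ex exY).
  - exact: (Ext0_adds aY aY WW).
  - exact: (Ext0_adds aY aM WW).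
  exact: (Ext0_adds aM aY WW).
exact: iso_trans (iso_trans WMY (dsumC _ _)) (dsum_iso YY' (iso_refl _)).
Qed.
End Count.

(** e_v is a combination of the dimension vectors, so they cannot all vanish at v. *)
Lemma T_pos v : exists j, (0 < rdim (X j) v)%N.
Proof.
have [i [p B]] := T_biproduct.
have [a /(_ v)] := family_span indX B (@T_Ext0) hQ T_max v.
rewrite eqxx => e; apply: NNPP => H; move: e; rewrite big1 // => j _.
case E : (rdim (X j) v) => [|d]; first by rewrite mulr0.
by case: H; exists j; rewrite E.
Qed.

Lemma T_dim j v : rdim T v = (rdim (cpl j) v + rdim (X j) v)%N.
Proof. exact: (iso_dim (T_cpl j)). Qed.

Definition sincere (j : J) : bool := [forall v, 0 < rdim (cpl j) v]%N.

(** A vertex missing from M_j would be missing from everything M_j generates or cogenerates, hence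
    from all X_k. *)
Lemma cpl_sincere j : gen (cpl j) (X j) \/ cogen (cpl j) (X j) -> sincere j.
Proof.
move=> H; apply/forallP => v; rewrite lt0n; apply/eqP => Mv.
have Xv : rdim (X j) v = 0%N.
  by case: H => [[N [f [MN [_ [y e]]]]]|[N [f [MN [_ [y e]]]]]]; apply/eqP;
  rewrite -leqn0 -(adds_dim0 MN Mv) (fmono_le e).
have [k] := T_pos v; rewrite ltnNge; case/negP; rewrite leqn0; apply/eqP.
have [->//|kj] := eqVneq k j; exact: adds_dim0 (cpl_X kj) Mv.
Qed.

Lemma sincere_dim : (forall j, sincere j) <-> (forall v, 2 <= rdim T v)%N.
Proof.
split=> [sinc v|dimT j].
  have [j Xj] := T_pos v; rewrite (T_dim j) -[2%N]/(1 + 1)%N leq_add //.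
  by have /forallP := sinc j; apply.
apply/forallP => v; rewrite lt0n; apply/eqP => Mv.
have [i [p B]] := T_biproduct.
have [a /(_ v)] := family_span indX B (@T_Ext0) hQ T_max v.
rewrite eqxx (bigD1 j) //= big1 => [|k kj]; last by rewrite (adds_dim0 (cpl_X kj) Mv) mulr0.
(* Integrality enters: an integer times a natural number is 1, so the latter is 1 and (dim T)_v = 0
   + 1. *)
rewrite addr0 => /(congr1 absz); rewrite abszM => /esym/eqP.
rewrite muln_eq1 => /andP [_ /eqP]; rewrite natz absz_nat => Xv.
by have := dimT v; rewrite (T_dim j) Mv Xv.
Qed.

Lemma saturated_sincere : saturated T <-> (forall j, sincere j).
Proof.
(* Excluded middle turns both conditions into Boolean predicates, whose supports can be counted. *)
have [cg cgE] : exists cg : J -> bool, forall j, cg j <-> cogen (cpl j) (X j).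
  apply: (fin_all_exists (P := fun j (b : bool) => b <-> cogen (cpl j) (X j))) => j.
  by case: (classic (cogen (cpl j) (X j))) => H; [exists true | exists false].
have [gn gnE] : exists gn : J -> bool, forall j, gn j <-> gen (cpl j) (X j).
  apply: (fin_all_exists (P := fun j (b : bool) => b <-> gen (cpl j) (X j))) => j.
  by case: (classic (gen (cpl j) (X j))) => H; [exists true | exists false].
have mutE T' : tq_arrow T T' <-> mutation (@exchange F n Ar s t) T'.
  split=> [[_ bT' [N [Z [Y [N' [f [g [TNZ TNY iZ iY ?]]]]]]]]|[bT' [N [Z [Y [TNZ TNY iZ iY]]]]]].
    by split=> //; exists N, Z, Y; split=> //; apply/exchange_inE; exists N', f, g.
  move=> /exchange_inE [N' [f [g ?]]]; split=> //.
  by exists N, Z, Y, N', f, g; split.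
have mutE' T' : tq_arrow T' T <-> mutation (fun M X Y => exchange M Y X) T'.
  split=> [[bT' _ [N [Y [Z [N' [f [g [TNY TNZ iY iZ ?]]]]]]]]|[bT' [N [Z [Y [TNZ TNY iZ iY]]]]]].
    by split=> //; exists N, Z, Y; split=> //; apply/exchange_inE; exists N', f, g.
  move=> /exchange_inE [N' [f [g ?]]]; split=> //.
  by exists N, Y, Z, N', f, g; split.
have numE (P Q : rep -> Prop) c : (forall T', P T' <-> Q T') -> num_iso_classes P c -> num_iso_classes Q c.
  move=> PQ [L [sL PL nL eL]]; exists L; split=> // [k kc|V /PQ]; last exact: eL.
  by apply/PQ/PL.
have out : num_iso_classes (fun T' => tq_arrow T T') #|cg|.
  apply: (numE _ _ _ (fun T' => iff_sym (mutE T'))); apply: (mutation_count (C := @cogen F n Ar s t)) => //.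
  - exact: exchange_iso.
  - exact: exchange_cogen.
  - by move=> M Z Y nZ /(exchange_nonsplit nZ).
  - exact: exchange_exists.
  - move=> M Z Y1 Y2 nZ iY1 iY2 EY1 EY1M _ EY2M _.
    exact: exchange_unique nZ iY1 iY2 EY1 EY1M EY2M.
have inn : num_iso_classes (fun T' => tq_arrow T' T) #|gn|.
  apply: (numE _ _ _ (fun T' => iff_sym (mutE' T'))); apply: (mutation_count (C := @gen F n Ar s t)) => //.
  - by move=> M Z Y M' Z' Y' MM' ZZ' YY'; apply: exchange_iso.
  - by move=> M Z Y; apply: exchange_gen.
  - by move=> M Z Y nZ ex ZY _; apply: exchange_nonsplit' nZ ex ZY.
  - exact: coexchange_exists.
  - move=> M Z Y1 Y2 nZ iY1 iY2 EY1 _ EY1M _ EY2M.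
    exact: coexchange_unique nZ iY1 iY2 EY1 EY1M EY2M.
have sE j : sincere j = cg j || gn j.
  apply/idP/orP => [/forallP sj|[/cgE|/gnE] H]; try by apply: cpl_sincere; auto.
  have maxM : maximal_rigid (dsum (cpl j) (X j)).
    exact: maximal_iso (T_cpl j) T_max.
  by have [/gnE|/cgE] := gen_or_cogen hQ (indX j) maxM sj; auto.
have disj j : cg j && gn j = false.
  by apply/negP => /andP [/cgE cj /gnE gj]; apply: (@cpl_nX j); apply: gen_cogen_split (@MM j) gj cj.
have card : #|sincere| = (#|cg| + #|gn|)%N.
  rewrite -cardUI addnC; have -> : #|[predI cg & gn]| = 0%N.
    by apply: eq_card0 => j; rewrite !inE; apply: disj.
  by apply: eq_card => j; rewrite !inE; apply: sE.
(* T has exactly n summands, so s(T) + e(T), the number of sincere complements, equals n only when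
   every complement is sincere. *)
have all_card : #|sincere| = n <-> forall j, sincere j.
  rewrite -T_card -[m in _ = m]card_ord; split=> [e j|sj].
    have /subset_cardP H : #|sincere| = #|{: J}| by [].
    by have /(_ j) := H (subset_predT _); rewrite !inE.
  by apply: eq_card => j; rewrite !inE; apply: sj.
rewrite -all_card card; split=> [[sT [eT [outs inns <-]]]|e].
  by rewrite (num_iso_unique out outs) (num_iso_unique inn inns).
by exists #|cg|, #|gn|.
Qed.

End TiltingFamily.
End Mutations.

Theorem theorem5p1 (k : closedFieldType) (n : nat) (Ar : finType)
    (s t : Ar -> 'I_n) (hQ : acyclic s t) (T : rep k s t)
    (hT : basic_tilting T) :
  saturated T <-> (forall i : 'I_n, 2 <= rdim T i).
Proof.
have [m [X [indX isoX TX]]] := family_of_basic (proj1 hT).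
exact: (iff_trans (saturated_sincere hQ indX isoX TX hT) (sincere_dim hQ indX TX hT)).
Qed.
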